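(* Every CAT(0) group of the form $G=F\times H$, where $F$ is a free group of rank $n\ge 2$ and $H$ is an infinite CAT(0) group, is not equivariant rigid.
   Context: A CAT(0) space is a proper geodesic metric space satisfying the CAT(0)-inequality for all geodesic triangles. A geometric action is an action by isometries that is proper and cocompact. A CAT(0) group is a group acting geometrically on some CAT(0) space. The boundary $\partial X$ is the set of geodesic rays modulo being at bounded distance, and $X\cup\partial X$ carries the usual cone topology. A CAT(0) group $G$ is equivariant rigid if for any two CAT(0) spaces $X$ and $Y$ on which $G$ acts geometrically there is a $G$-equivariant homeomorphism $\bar\phi:\partial X\to\partial Y$ which is a continuous extension of the quasi-isometry $\phi:Gx_0\to Gy_0$, $\phi(gx_0)=gy_0$, where $x_0\in X$ and $y_0\in Y$. Here ''continuous extension'' means that whenever $\{g_i\}\subset G$ is a sequence with $g_ix_0\to\alpha\in\partial X$ in $X\cup\partial X$, then $g_iy_0\to\bar\phi(\alpha)$ in $Y\cup\partial Y$ (and $\bar\phi$ is continuous). *)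

(* Defs.v *)
From HB Require Import structures.
From mathcomp Require Import all_boot all_order all_algebra.
From mathcomp Require Import all_classical all_reals all_analysis.

Set Implicit Arguments.
Unset Strict Implicit.
Unset Printing Implicit Defensive.

Import Order.TTheory GRing.Theory Num.Theory.

Local Open Scope classical_set_scope.
Local Open Scope ring_scope.
Local Open Scope quotient_scope.

(** * CAT(0) spaces *)

(* Euclidean distance; the library's norm on R * R is the max norm. *)
Definition edist (R : realType) (a b : R * R) : R :=
  Num.sqrt ((a.1 - b.1) ^+ 2 + (a.2 - b.2) ^+ 2).

Definition esegment (R : realType) (a b : R * R) : set (R * R) :=
  [set ((1 - t) * a.1 + t * b.1, (1 - t) * a.2 + t * b.2) | t in `[0, 1]].

Section CAT0.
Context {R : realType} (X : metricType R).

(* [c], restricted to [0, d(x, y)], is a geodesic from [x] to [y]; its values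
   outside this interval are irrelevant. *)
Definition geodesic (c : R -> X) (x y : X) : Prop :=
  [/\ c 0 = x, c (mdist x y) = y &
      {in `[0, mdist x y] &, forall s t, mdist (c s) (c t) = `|s - t|}].

Definition geodesic_space : Prop := forall x y : X, exists c, geodesic c x y.

Definition proper_space : Prop :=
  forall (x : X) (r : R), compact [set y | mdist x y <= r].

(* [x'] on the side [p', q'] of a comparison triangle is a comparison point for
   [x] on the geodesic segment [c] from [p] to [q]. *)
Definition side_comparison (c : R -> X) (p q : X) (p' q' : R * R)
    (x : X) (x' : R * R) : Prop :=
  [/\ (c @` `[0, mdist p q]) x, esegment p' q' x' & mdist p x = edist p' x'].

Definition CAT0_inequality : Prop :=
  forall (p q r : X) (cpq cqr crp : R -> X),
    geodesic cpq p q -> geodesic cqr q r -> geodesic crp r p ->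
  forall p' q' r' : R * R,
    edist p' q' = mdist p q -> edist q' r' = mdist q r ->
    edist r' p' = mdist r p ->
  let comparison x x' :=
    [\/ side_comparison cpq p q p' q' x x',
        side_comparison cqr q r q' r' x x' |
        side_comparison crp r p r' p' x x'] in
  forall (x y : X) (x' y' : R * R),
    comparison x x' -> comparison y y' -> mdist x y <= edist x' y'.

(* Nonemptiness is the usual implicit convention; without it every group would
   act geometrically on the empty space. *)
Definition CAT0_space : Prop :=
  [/\ [set: X] !=set0, proper_space, geodesic_space & CAT0_inequality].

End CAT0.

(** * Boundary and cone topology *)

(* Only the restriction of a ray to nonnegative reals is meaningful; [asymptotic]
   identifies rays that agree there. *)
Record ray {R : realType} (X : metricType R) := Ray {
  ray_fun :> R -> X ;
  ray_isometric : forall s t, 0 <= s -> 0 <= t ->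
    mdist (ray_fun s) (ray_fun t) = `|s - t|
}.

HB.instance Definition _ (R : realType) (X : metricType R) :=
  gen_eqMixin (ray X).
HB.instance Definition _ (R : realType) (X : metricType R) :=
  gen_choiceMixin (ray X).

Section Boundary.
Context {R : realType} (X : metricType R).

Definition asymptotic (c c' : ray X) : Prop :=
  exists K : R, forall t, 0 <= t -> mdist (c t) (c' t) <= K.

Lemma asymptotic_refl : reflexive (fun c c' => `[< asymptotic c c' >]).
Proof. by move=> c; apply/asboolP; exists 0 => t _; rewrite mdistxx. Qed.

Lemma asymptotic_sym : symmetric (fun c c' => `[< asymptotic c c' >]).
Proof.
by move=> c c'; apply/asbool_equiv_eq; split=> -[K cK]; exists K => t t0;
  rewrite metric_sym; exact: cK.
Qed.

Lemma asymptotic_trans : transitive (fun c c' => `[< asymptotic c c' >]).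
Proof.
move=> c2 c1 c3 /asboolP[K cK] /asboolP[L cL]; apply/asboolP.
exists (K + L) => t t0.
by rewrite (le_trans (metric_triangle _ (c2 t) _))// lerD ?cK ?cL.
Qed.

Definition asymptotic_rel :=
  EquivRel _ asymptotic_refl asymptotic_sym asymptotic_trans.

Definition boundary := {eq_quot asymptotic_rel}.

HB.instance Definition _ := Choice.on boundary.

Definition endpoint (c : ray X) : boundary := \pi c.

Lemma endpointP (c c' : ray X) : endpoint c = endpoint c' <-> asymptotic c c'.
Proof.
rewrite /endpoint; split=> [/eqmodP|] /=; first by move/asboolP.
by move=> h; apply/eqmodP/asboolP.
Qed.

(* The disjoint union of [X] and its boundary. *)
Definition bordification : Type := (X + boundary)%type.

HB.instance Definition _ := Choice.on bordification.

Definition interior_point (x : X) : bordification := inl x.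
Definition ideal_point (xi : boundary) : bordification := inr xi.

(* U(c, r, e): the points of the bordification outside the closed ball of
   radius r around c 0 whose projection to that ball, i.e. the point at distance
   r from c 0 on the geodesic or ray issuing from c 0, is e-close to c r. *)
Definition cone_nbhd (c : ray X) (r e : R) : set bordification :=
  fun z => match z with
  | inl x => r < mdist (c 0) x /\
      exists2 s : R -> X, geodesic s (c 0) x & mdist (s r) (c r) < e
  | inr xi => exists c' : ray X,
      [/\ endpoint c' = xi, c' 0 = c 0 & mdist (c' r) (c r) < e]
  end.

(* All base points are used at once: in a complete CAT(0) space the cone
   topologies for the various base points coincide. *)
Definition cone_subbase : set (set bordification) :=
  [set U | (exists2 A : set X, open A & U = interior_point @` A) \/
           (exists c r e, [/\ 0 < r, 0 < e & U = cone_nbhd c r e])].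

HB.instance Definition _ :=
  @isSubBaseTopological.Build bordification (set bordification) cone_subbase id.

HB.instance Definition _ :=
  Topological.copy boundary (initial_topology ideal_point).

End Boundary.

(** * Geometric actions *)

Record isometric_action {R : realType} (G : groupType) (X : metricType R) :=
  IsometricAction {
    act :> G -> X -> X ;
    act1 : forall x, act 1%g x = x ;
    actM : forall g h x, act (g * h)%g x = act g (act h x) ;
    act_isometric : forall g x y, mdist (act g x) (act g y) = mdist x y
  }.

Section Actions.
Context {R : realType} {G : groupType} {X : metricType R}.
Implicit Type a : isometric_action G X.

Definition proper_action a : Prop :=
  forall K : set X, compact K ->
    finite_set [set g : G | (a g @` K) `&` K !=set0].

Definition cocompact_action a : Prop :=
  exists2 K : set X, compact K & \bigcup_(g in [set: G]) (a g @` K) = [set: X].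

Definition geometric_action a : Prop := proper_action a /\ cocompact_action a.

Lemma translate_isometric a g (c : ray X) s t : 0 <= s -> 0 <= t ->
  mdist (a g (c s)) (a g (c t)) = `|s - t|.
Proof. by move=> s0 t0; rewrite act_isometric ray_isometric. Qed.

Definition translate a g (c : ray X) : ray X := Ray (translate_isometric a g c).

Definition boundary_act a g (xi : boundary X) : boundary X :=
  endpoint (translate a g (repr xi)).

Lemma boundary_actE a g (c : ray X) :
  boundary_act a g (endpoint c) = endpoint (translate a g c).
Proof.
apply/endpointP; have [K cK] : asymptotic (repr (endpoint c)) c.
  by apply/endpointP; rewrite /endpoint reprK.
by exists K => t t0; rewrite act_isometric cK.
Qed.

End Actions.

(** * CAT(0) groups and equivariant rigidity *)

Definition CAT0_group (R : realType) (G : groupType) : Prop :=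
  exists X : metricType R, CAT0_space X /\
  exists a : isometric_action G X, geometric_action a.

Definition homeomorphism (S T : topologicalType) (f : S -> T) : Prop :=
  continuous f /\
  exists g : T -> S, [/\ continuous g, cancel f g & cancel g f].

Section Rigidity.
Context {R : realType} {G : groupType} {X Y : metricType R}.
Variables (a : isometric_action G X) (b : isometric_action G Y).

Definition equivariant (f : boundary X -> boundary Y) : Prop :=
  forall g xi, f (boundary_act a g xi) = boundary_act b g (f xi).

(* [f] continuously extends the map g x0 |-> g y0 between the orbits. This map
   is well defined only up to stabilizers, hence the formulation in terms of
   sequences in the group. *)
Definition extends_orbit_map (x0 : X) (y0 : Y)
    (f : boundary X -> boundary Y) : Prop :=
  continuous f /\
  forall (g : nat -> G) (alpha : boundary X),
    interior_point (a (g i) x0) @[i --> \oo] --> ideal_point alpha ->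
    interior_point (b (g i) y0) @[i --> \oo] --> ideal_point (f alpha).

End Rigidity.

Definition equivariant_rigid (R : realType) (G : groupType) : Prop :=
  forall (X Y : metricType R) (a : isometric_action G X)
         (b : isometric_action G Y),
    CAT0_space X -> CAT0_space Y -> geometric_action a -> geometric_action b ->
  forall (x0 : X) (y0 : Y), exists f : boundary X -> boundary Y,
    [/\ homeomorphism f, equivariant a b f & extends_orbit_map a b x0 y0 f].

(** * Free groups *)

(* [F] is free of rank [n]: some n-element family has the universal property of
   a basis. *)
Definition free_group_of_rank (n : nat) (F : groupType) : Prop :=
  exists x : 'I_n -> F, forall (K : groupType) (y : 'I_n -> K),
    exists! f : F -> K, {morph f : u v / (u * v)%g} /\ forall i, f (x i) = y i.

(* Main.v *)
From HB Require Import structures.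
From mathcomp Require Import all_boot all_order all_algebra.
From mathcomp Require Import finmap.
From mathcomp Require Import all_classical all_reals all_analysis.
From mathcomp Require Import ring lra.
Require Import Defs.

Set Implicit Arguments.
Unset Strict Implicit.
Unset Printing Implicit Defensive.

Import Order.TTheory GRing.Theory Num.Theory.
Import numFieldNormedType.Exports.
Import metricType_numDomainType.

Local Open Scope classical_set_scope.
Local Open Scope ring_scope.

(** Let [H] act geometrically on the CAT(0) space [Y], and let [F], free on
    generators containing [a] and [b], act on two copies [T1], [T2] of its Cayley
    tree, where every edge has length 1 in [T1] and exactly the [b]-edges have length 2
    in [T2], the other edges having length 1. Then [F * H] acts geometrically on
    the l2 products of [T1] and [T2] with [Y], and the two sequences
      [(a ^ (2 * k), h)]   and   [(a ^ k * b ^ k, h)]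
    of group elements, where [h] runs through elements of [H] escaping to infinity
    and [k] is the integer part of [mdist y0 (h y0)], distinguish the boundaries.

    In the product of [T1] and [Y], both orbit sequences lie at the same distance
    from the base point, and the segments leading to them coincide on their first
    halves, because the two words share the prefix [a ^ k]. Along a subsequence they
    therefore converge to one and the same boundary point
    ([segments_subconverge], [segments_converge_shared_half]). In the product of
    [T2] and [Y], the tree components have lengths [2 * k] and [3 * k] while the
    [Y]-components agree, so the segments from any base point leave in
    directions whose [Y]-components have different speeds, tending to
    [1 / sqrt 5] and [1 / sqrt 10], and the two sequences have no common limit
    ([slopes_differ]). A map of boundaries that extends the orbit map continuously
    would send the common limit of the first product to a common limit in the
    second one.

    CAT(0) spaces enter through the Bruhat-Tits (CN) inequality, which is equivalent
    to the comparison axiom ([CAT0_CN], [CN_CAT0_inequality]) and passes to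
    l2 products at once ([CN_prod]). The trees are obtained from the word metric
    of [F] by adding the points of all segments between vertices: for a metric
    with the four-point condition this gives a space satisfying the CN inequality
    ([CN_tree_hull]). The four-point condition of the word metric comes from
    reduced words, which are available since the universal property of [F] makes
    [F] act on them ([normal_form_exists]). *)

(** * The CN inequality *)

Lemma div_itv01 (R : realType) (r D : R) :
  0 <= r <= D -> 0 < D -> 0 <= r / D <= 1.
Proof. by move=> h D0; rewrite ler_pdivrMr// ler_pdivlMr// mul0r mul1r. Qed.

Section FractionPoints.
Context {R : realType} (X : metricType R).
Implicit Types (p q m x y z : X) (s t : R).

(** The CN inequality at the point [m] dividing the segment from [p] to [q] in
    the ratio [t : 1 - t]. For [0 <= t <= 1] it forces [m] to have the distances
    [t * mdist p q] and [(1 - t) * mdist p q] to [p] and [q], and to be the only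
    such point. *)
Definition fraction_point t p q m : Prop := forall r : X,
  mdist r m ^+ 2 <= (1 - t) * mdist r p ^+ 2 + t * mdist r q ^+ 2
                    - t * (1 - t) * mdist p q ^+ 2.

Definition CN_inequality : Prop := forall t p q, 0 <= t <= 1 ->
  exists m, fraction_point t p q m.

Lemma le_of_sqr (a b : R) : 0 <= b -> a ^+ 2 <= b ^+ 2 -> a <= b.
Proof. by move=> b0 ab; rewrite leNgt; apply/negP => ba; nra. Qed.

Lemma fraction_point_sym t p q m :
  fraction_point t p q m -> fraction_point (1 - t) q p m.
Proof.
by move=> h r; apply: (le_trans (h r)); rewrite (metric_sym q p); lra.
Qed.

Lemma fraction_point_le t p q m : 0 <= t <= 1 -> fraction_point t p q m ->
  mdist p m <= t * mdist p q.
Proof.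
move=> /andP[t0 t1] /(_ p); rewrite mdistxx => h.
by apply: le_of_sqr; [rewrite mulr_ge0// mdist_ge0 | lra].
Qed.

Lemma fraction_point_dist t p q m : 0 <= t <= 1 -> fraction_point t p q m ->
  mdist p m = t * mdist p q /\ mdist m q = (1 - t) * mdist p q.
Proof.
move=> t01 h; have h1 := fraction_point_le t01 h.
have t01' : 0 <= 1 - t <= 1 by lra.
have := fraction_point_le t01' (fraction_point_sym h).
rewrite (metric_sym q m) (metric_sym q p) => h2.
by have := metric_triangle p m q; split; lra.
Qed.

(** The CN inequality for [m], tested at [x], bounds [mdist x m ^+ 2] by 0. *)
Lemma fraction_point_unique t p q m x : 0 <= t <= 1 ->
  fraction_point t p q m ->
  mdist p x <= t * mdist p q -> mdist x q <= (1 - t) * mdist p q -> x = m.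
Proof.
move=> /andP[t0 t1] /(_ x) h px xq; apply: mdist_positivity; apply/eqP.
rewrite -sqrf_eq0 eq_le sqr_ge0 andbT (le_trans h)//.
have t0' : 0 <= 1 - t by lra.
have h1 : mdist x p ^+ 2 <= (t * mdist p q) ^+ 2.
  by rewrite lerXn2r ?nnegrE ?mulr_ge0 ?mdist_ge0// metric_sym.
have h2 : mdist x q ^+ 2 <= ((1 - t) * mdist p q) ^+ 2.
  by rewrite lerXn2r ?nnegrE ?mulr_ge0 ?mdist_ge0.
have h3 := ler_wpM2l t0 h2.
have h4 := ler_wpM2l t0' h1.
apply: (le_trans (_ : _ <= (1 - t) * (t * mdist p q) ^+ 2 +
  t * ((1 - t) * mdist p q) ^+ 2 - t * (1 - t) * mdist p q ^+ 2)); first by lra.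
by rewrite le_eqVlt; apply/orP; left; apply/eqP; ring.
Qed.

(** Using the inequality once for each of the two points bounds their distance by
    the distances between the four ends; in the Euclidean plane this bound is an
    equality ([edist_quadrilateral]). *)
Lemma fraction_points_quadrilateral s t p q u v x y : 0 <= t <= 1 ->
  fraction_point t p q x -> fraction_point s u v y ->
  mdist x y ^+ 2 <=
    (1 - t) * ((1 - s) * mdist p u ^+ 2 + s * mdist p v ^+ 2
               - s * (1 - s) * mdist u v ^+ 2)
    + t * ((1 - s) * mdist q u ^+ 2 + s * mdist q v ^+ 2
           - s * (1 - s) * mdist u v ^+ 2)
    - t * (1 - t) * mdist p q ^+ 2.
Proof.
move=> /andP[t0 t1] /(_ y) hx hy; rewrite metric_sym; apply: (le_trans hx).
have t0' : 0 <= 1 - t by lra.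
have := ler_wpM2l t0' (hy p); have := ler_wpM2l t0 (hy q).
by rewrite (metric_sym y p) (metric_sym y q); lra.
Qed.

Lemma fraction_points_same_side s t p q x y :
  0 <= s <= 1 -> 0 <= t <= 1 ->
  fraction_point s p q x -> fraction_point t p q y ->
  mdist x y = `|s - t| * mdist p q.
Proof.
move=> s01 t01 hx hy; apply/eqP; rewrite eq_le; apply/andP; split.
  apply: le_of_sqr; first by rewrite mulr_ge0 ?mdist_ge0.
  apply: (le_trans (fraction_points_quadrilateral s01 hx hy)).
  rewrite !mdistxx (metric_sym q p) exprMn real_normK ?num_real//.
  by rewrite le_eqVlt; apply/orP; left; apply/eqP; ring.
have [px _] := fraction_point_dist s01 hx.
have [py _] := fraction_point_dist t01 hy.
have h1 := metric_triangle p x y; have h2 := metric_triangle p y x.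
rewrite (metric_sym y x) in h2.
by have [st|st] := lerP s t; lra.
Qed.

(** The side [p q] of a triangle with apex [z] shrinks by the factor [t] on the way
    to the apex: the quadrilateral bound for the pairs [z p] and [z q] collapses to
    the square of [t * mdist p q]. *)
Lemma fraction_points_cone t z p q x y : 0 <= t <= 1 ->
  fraction_point t z p x -> fraction_point t z q y ->
  mdist x y <= t * mdist p q.
Proof.
move=> t01 hx hy; apply: le_of_sqr.
  by case/andP: t01 => t0 _; rewrite mulr_ge0 ?mdist_ge0.
apply: (le_trans (fraction_points_quadrilateral t01 hx hy)).
rewrite mdistxx (metric_sym p z).
by rewrite le_eqVlt; apply/orP; left; apply/eqP; ring.
Qed.

Lemma geodesic_dist (c : R -> X) p q s : 0 <= s <= mdist p q ->
  geodesic c p q -> mdist p (c s) = s /\ mdist (c s) q = mdist p q - s.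
Proof.
move=> /[dup] sd /andP[s0 s1] [c0 c1 cd]; have d0 := mdist_ge0 p q.
have := cd 0 s; have := cd s (mdist p q); rewrite c0 c1 !in_itv/= !lexx sd d0.
move=> /(_ isT isT) -> /(_ isT isT) ->.
by rewrite sub0r normrN ger0_norm// ler0_norm ?subr_le0// opprB.
Qed.

End FractionPoints.

Section CN.
Context {R : realType} {X : metricType R} (cn : CN_inequality X).
Implicit Types (p q m x y z : X) (s t : R).

Lemma fraction_pointI t p q m : 0 <= t <= 1 ->
  mdist p m <= t * mdist p q -> mdist m q <= (1 - t) * mdist p q ->
  fraction_point t p q m.
Proof.
move=> t01 pm mq; have [x hx] := cn p q t01.
by rewrite (fraction_point_unique t01 hx pm mq).
Qed.

Lemma geodesic_fraction_point (c : R -> X) p q t : 0 <= t <= 1 ->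
  geodesic c p q -> fraction_point t p q (c (t * mdist p q)).
Proof.
move=> /[dup] t01 /andP[t0 t1] gc; have d0 := mdist_ge0 p q.
have [|h1 h2] := geodesic_dist (s := t * mdist p q) _ gc.
  by rewrite mulr_ge0//= ler_piMl.
by apply: fraction_pointI => //; rewrite ?h1 ?h2//; lra.
Qed.

Lemma geodesic_fraction_point_div (c : R -> X) p q r :
  0 <= r <= mdist p q -> 0 < mdist p q ->
  geodesic c p q -> fraction_point (r / mdist p q) p q (c r).
Proof.
move=> rd d0 gc; rewrite -{2}(divfK (lt0r_neq0 d0) r).
exact: geodesic_fraction_point (div_itv01 rd d0) gc.
Qed.

(** The points dividing [p q] in all ratios form a geodesic, by
    [fraction_points_same_side]. *)
Lemma CN_geodesic_space : geodesic_space X.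
Proof.
move=> p q; set D := mdist p q; have D0 : 0 <= D by exact: mdist_ge0.
have [D_eq0|D_gt0] := eqVneq D 0.
  exists (fun=> p); split=> //; first exact: mdist_positivity.
  move=> s t; rewrite -/D D_eq0 !in_itv/= -!eq_le => /eqP <- /eqP <-.
  by rewrite mdistxx subrr normr0.
have {}D_gt0 : 0 < D by rewrite lt_neqAle eq_sym D_gt0.
have /choice[c hc] : forall r, exists m, 0 <= r <= D -> fraction_point (r / D) p q m.
  move=> r; have [rD|_] := boolP (0 <= r <= D); last by exists p.
  by have [m hm] := cn p q (div_itv01 rD D_gt0); exists m.
have hc' r : 0 <= r <= D -> 0 <= r / D <= 1 by move=> rD; apply: div_itv01.
exists c; split.
- have h0 : 0 <= (0 : R) <= D by rewrite lexx D0.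
  have [+ _] := fraction_point_dist (hc' _ h0) (hc _ h0).
  by rewrite !mul0r => /mdist_positivity.
- have h1 : 0 <= D <= D by rewrite lexx D0.
  have [_ +] := fraction_point_dist (hc' _ h1) (hc _ h1).
  by rewrite divff ?gt_eqF// subrr mul0r => /mdist_positivity.
- move=> s t; rewrite !in_itv/= => hs ht.
  rewrite (fraction_points_same_side (hc' _ hs) (hc' _ ht) (hc _ hs) (hc _ ht)).
  by rewrite -mulrBl normrM -mulrA normfV (gtr0_norm D_gt0) mulVf ?mulr1 ?gt_eqF.
Qed.

(** Geodesics are unique, hence a fraction point lies on every geodesic between
    its ends. *)
Lemma geodesic_from_fraction_point p q x r : 0 <= r <= mdist p q ->
  0 < mdist p q -> fraction_point (r / mdist p q) p q x ->
  exists2 c : R -> X, geodesic c p q & c r = x.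
Proof.
move=> rd d0 hx; have [c gc] := CN_geodesic_space p q; exists c => //.
have hc := geodesic_fraction_point_div rd d0 gc.
have t01 := div_itv01 rd d0; have [h1 h2] := fraction_point_dist t01 hc.
by apply: (fraction_point_unique t01 hx); rewrite ?h1 ?h2.
Qed.

End CN.

Section Euclid.
Context {R : realType}.
Implicit Types (a b p q x y : R * R) (s t : R).

Lemma edist_ge0 a b : 0 <= edist a b.
Proof. exact: sqrtr_ge0. Qed.

Lemma edist_sqr a b : edist a b ^+ 2 = (a.1 - b.1) ^+ 2 + (a.2 - b.2) ^+ 2.
Proof. by rewrite sqr_sqrtr// addr_ge0 ?sqr_ge0. Qed.

Lemma edist_sym a b : edist a b = edist b a.
Proof. by rewrite /edist; congr Num.sqrt; ring. Qed.

Lemma edistxx a : edist a a = 0.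
Proof. by rewrite /edist !subrr expr0n/= addr0 sqrtr0. Qed.

Lemma esegmentP p q x : esegment p q x <-> exists2 t, 0 <= t <= 1 &
  x = ((1 - t) * p.1 + t * q.1, (1 - t) * p.2 + t * q.2).
Proof.
by split=> -[t]; rewrite ?in_itv/= => t01 E; exists t; rewrite ?in_itv.
Qed.

Lemma edist_segment p q t : 0 <= t <= 1 ->
  edist p ((1 - t) * p.1 + t * q.1, (1 - t) * p.2 + t * q.2) = t * edist p q.
Proof.
move=> /andP[t0 _]; apply/eqP.
rewrite -(@eqrXn2 _ 2) ?edist_ge0 ?mulr_ge0 ?edist_ge0//.
by rewrite exprMn !edist_sqr/=; apply/eqP; ring.
Qed.

Lemma edist_quadrilateral p q u v s t :
  edist ((1 - t) * p.1 + t * q.1, (1 - t) * p.2 + t * q.2)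
        ((1 - s) * u.1 + s * v.1, (1 - s) * u.2 + s * v.2) ^+ 2 =
    (1 - t) * ((1 - s) * edist p u ^+ 2 + s * edist p v ^+ 2
               - s * (1 - s) * edist u v ^+ 2)
    + t * ((1 - s) * edist q u ^+ 2 + s * edist q v ^+ 2
           - s * (1 - s) * edist u v ^+ 2)
    - t * (1 - t) * edist p q ^+ 2.
Proof. by rewrite !edist_sqr/=; ring. Qed.

(** The side of length [c] is put on the first axis; the law of cosines then gives
    the first coordinate of the third vertex. *)
Lemma comparison_triangle (a b c : R) : 0 <= a -> 0 <= b -> 0 <= c ->
  a <= b + c -> b <= a + c -> c <= a + b ->
  exists p q r : R * R, [/\ edist p q = c, edist q r = b & edist r p = a].
Proof.
move=> a0 b0 c0 abc bac cab.
have edistE x y (d : R) : 0 <= d ->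
    (x.1 - y.1) ^+ 2 + (x.2 - y.2) ^+ 2 = d ^+ 2 -> edist x y = d.
  by move=> d0 E; rewrite /edist E sqrtr_sqr ger0_norm.
have [cE|c_gt0] := eqVneq c 0.
  exists (0, 0), (0, 0), (a, 0); have -> : b = a by lra.
  by split; apply: edistE => //=; rewrite ?cE; ring.
have {}c_gt0 : 0 < c by rewrite lt_neqAle eq_sym c_gt0.
pose u := (a ^+ 2 + c ^+ 2 - b ^+ 2) / (2 * c).
have uE : 2 * c * u = a ^+ 2 + c ^+ 2 - b ^+ 2.
  by rewrite /u mulrCA divff ?mulr1// mulf_neq0 ?pnatr_eq0 ?gt_eqF.
have u_le : u <= a.
  rewrite ler_pdivrMr; last lra.
  have : 0 <= (b - (c - a)) * (b + (c - a)) by apply: mulr_ge0; lra.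
  by lra.
have u_ge : - a <= u.
  rewrite ler_pdivlMr; last lra.
  have : 0 <= (a + c - b) * (a + c + b) by apply: mulr_ge0; lra.
  by lra.
have au : 0 <= a ^+ 2 - u ^+ 2.
  have : 0 <= (a - u) * (a + u) by apply: mulr_ge0; lra.
  by lra.
exists (0, 0), (c, 0), (u, Num.sqrt (a ^+ 2 - u ^+ 2)).
split; apply: edistE => //=; first by ring.
  by rewrite sub0r sqrrN sqr_sqrtr//; lra.
by rewrite !subr0 sqr_sqrtr//; lra.
Qed.

End Euclid.

Section CAT0_CN.
Context {R : realType} {X : metricType R}.

(** Two comparison points lie on two sides [a b] and [u v] of the triangle, equal or
    not; the six distances between [a], [b], [u], [v] agree with the Euclidean ones,
    so the quadrilateral bound compares the two points in all nine cases. *)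
Lemma CN_CAT0_inequality : CN_inequality X -> CAT0_inequality X.
Proof.
move=> cn p q r cpq cqr crp gpq gqr grp p' q' r' pq qr rp comparison.
have side c (a b : X) a' b' x x' : geodesic c a b -> edist a' b' = mdist a b ->
    side_comparison c a b a' b' x x' ->
    exists t, [/\ 0 <= t <= 1, fraction_point t a b x &
      x' = ((1 - t) * a'.1 + t * b'.1, (1 - t) * a'.2 + t * b'.2)].
  move=> gc ab [[s + cs] /esegmentP[t t01 x'E] ax]; rewrite /= in_itv/= => s01.
  exists t; split => //.
  move: ax; rewrite x'E edist_segment// ab -cs.
  have [-> _] := geodesic_dist s01 gc; move=> ->.
  exact: geodesic_fraction_point.
have all_sides x x' : comparison x x' -> exists a b a' b' t,
    [/\ [/\ a = p & a' = p'] \/ ([/\ a = q & a' = q'] \/ [/\ a = r & a' = r']),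
        [/\ b = p & b' = p'] \/ ([/\ b = q & b' = q'] \/ [/\ b = r & b' = r']),
        0 <= t <= 1, fraction_point t a b x &
        x' = ((1 - t) * a'.1 + t * b'.1, (1 - t) * a'.2 + t * b'.2)].
  by case=> /side[]// t [t01 hx x'E];
    [exists p, q, p', q', t|exists q, r, q', r', t|exists r, p, r', p', t];
    split=> //; tauto.
move=> x y x' y' /all_sides[a [b [a' [b' [t [ha hb t01 hx ->]]]]]].
move=> /all_sides[u [v [u' [v' [s [hu hv s01 hy ->]]]]]].
have vertices (a1 b1 : X) a1' b1' :
    [/\ a1 = p & a1' = p'] \/ ([/\ a1 = q & a1' = q'] \/ [/\ a1 = r & a1' = r']) ->
    [/\ b1 = p & b1' = p'] \/ ([/\ b1 = q & b1' = q'] \/ [/\ b1 = r & b1' = r']) ->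
    mdist a1 b1 = edist a1' b1'.
  by move=> [[-> ->]|[[-> ->]|[-> ->]]] [[-> ->]|[[-> ->]|[-> ->]]];
    rewrite ?mdistxx ?edistxx// ?pq ?qr ?rp// edist_sym ?pq ?qr ?rp metric_sym.
apply: le_of_sqr; first exact: edist_ge0.
apply: (le_trans (fraction_points_quadrilateral t01 hx hy)).
rewrite edist_quadrilateral (vertices a b a' b')// (vertices u v u' v')//.
by rewrite (vertices a u a' u')// (vertices a v a' v')// (vertices b u b' u')//
  (vertices b v b' v').
Qed.

(** The comparison of the vertex [r] with a point of the opposite side is the CN
    inequality, since the latter is an identity in the plane. *)
Lemma CAT0_CN : geodesic_space X -> CAT0_inequality X -> CN_inequality X.
Proof.
move=> geo cat t p q t01.
have [c gc] := geo p q; exists (c (t * mdist p q)) => r.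
have [cqr gqr] := geo q r; have [crp grp] := geo r p.
have [p' [q' [r' [pq qr rp]]]] : exists p' q' r' : R * R,
    [/\ edist p' q' = mdist p q, edist q' r' = mdist q r & edist r' p' = mdist r p].
  apply: comparison_triangle; rewrite ?mdist_ge0//.
  - by rewrite (metric_sym r p) addrC metric_triangle.
  - by rewrite addrC (metric_sym r p) (metric_sym p q) metric_triangle.
  - by rewrite (metric_sym r p) (metric_sym q r) metric_triangle.
have d0 := mdist_ge0 p q; have [t0 t1] := andP t01.
have td : 0 <= t * mdist p q <= mdist p q by rewrite mulr_ge0//= ler_piMl.
have [px _] := geodesic_dist td gc.
set x' : R * R := ((1 - t) * p'.1 + t * q'.1, (1 - t) * p'.2 + t * q'.2).
have side_x : side_comparison c p q p' q' (c (t * mdist p q)) x'.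
  split; first by exists (t * mdist p q); rewrite //= in_itv.
    by apply/esegmentP; exists t.
  by rewrite edist_segment// pq.
have side_r : side_comparison crp r p r' p' r r'.
  split; first by exists 0; [rewrite /= in_itv/= lexx mdist_ge0|case: grp].
    apply/esegmentP; exists 0; first by rewrite lexx ler01.
    by rewrite subr0 !mul1r !mul0r !addr0; case: (r').
  by rewrite mdistxx edistxx.
have := cat _ _ _ _ _ _ gc gqr grp _ _ _ pq qr rp _ _ _ _ (Or33 _ _ side_r) (Or31 _ _ side_x).
move=> h; have {}h : mdist r (c (t * mdist p q)) ^+ 2 <= edist r' x' ^+ 2.
  by rewrite lerXn2r ?nnegrE ?mdist_ge0 ?edist_ge0.
apply: (le_trans h); rewrite edist_sym -(metric_sym q r) -pq -qr -rp.
rewrite (edist_sym q' r') !edist_sqr/=.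
by rewrite le_eqVlt; apply/orP; left; apply/eqP; ring.
Qed.

End CAT0_CN.

(** * Convergence to boundary points *)

Section ConeTopology.
Context {R : realType} {X : metricType R}.
Implicit Types (c : ray X) (p : nat -> X) (r e : R).

Lemma open_cone_nbhd c r e : 0 < r -> 0 < e ->
  open (cone_nbhd c r e : set (bordification X)).
Proof.
move=> r0 e0; exists [set cone_nbhd c r e]; last first.
  by rewrite predeqE => ?; split=> [[_ ->]|] //; exists (cone_nbhd c r e).
move=> _ ->; exists [fset (cone_nbhd c r e : set (bordification X))]%fset.
  by move=> U; rewrite inE inE => /eqP ->; right; exists c, r, e.
by rewrite predeqE => ?; split=> [|? ?]; [apply|]; rewrite /= inE // =>/eqP->.
Qed.

(** The subbasic sets coming from open sets of [X] contain no ideal point, so only the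
    sets [cone_nbhd] matter. *)
Lemma cvg_ideal_point (z : nat -> bordification X) (xi : boundary X) :
  (forall c r e, 0 < r -> 0 < e -> cone_nbhd c r e (ideal_point xi) ->
     \forall i \near \oo, cone_nbhd c r e (z i)) ->
  z i @[i --> \oo] --> ideal_point xi.
Proof.
move=> cvz A; rewrite nbhsE => -[_ [[B sB <-] [C BC Ct] sUBA]].
rewrite nbhs_filterE; apply: filterS sUBA _; apply: (@filterS _ _ _ C).
  by move=> ? ?; exists C.
have /sB [D sD IDeC] := BC; rewrite -IDeC; apply: filter_bigI => E DE.
have Exi : E (ideal_point xi) by move: Ct; rewrite -IDeC => /(_ _ DE).
have /sD := DE; rewrite inE => -[[A' _ EE]|[c [r [e [r0 e0 EE]]]]].
  by move: Exi; rewrite EE => -[].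
by rewrite EE in Exi *; exact: (cvz c r e).
Qed.

Lemma cvg_ideal_point_near (z : nat -> bordification X) c r e :
  0 < r -> 0 < e ->
  z i @[i --> \oo] --> ideal_point (endpoint c) ->
  \forall i \near \oo, cone_nbhd c r e (z i).
Proof.
move=> r0 e0; apply; apply: open_nbhs_nbhs; split; first exact: open_cone_nbhd.
by exists c; split=> //; rewrite mdistxx.
Qed.

(** The geodesic segments from [c 0] to the points [p i] become arbitrarily long and
    converge pointwise to the ray [c]. *)
Definition segments_converge p c : Prop := forall r e, 0 < r -> 0 < e ->
  \forall i \near \oo, r < mdist (c 0) (p i) /\
    exists2 m, fraction_point (r / mdist (c 0) (p i)) (c 0) (p i) m &
               mdist m (c r) < e.

Context (cn : CN_inequality X).

(** Change of base point, quantitatively. Let [m] lie at distance [t] from [c 0] on the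
    segment to [q], close to [c t], and let [c1] be a ray asymptotic to [c]. The
    segment from [c1 0] to [q] passes near [m], since both segments end at [q];
    hence at time [t] it is within [2 * (K + 1 + L)] of [c1 t]. Contracting towards
    [c1 0] divides this bound by [t / r] at time [r]. *)
Lemma asymptotic_rays_close c c1 (K L r t : R) (q : X) (D : R) (m : X) :
  0 < r -> r <= t -> 0 < t -> t < D -> t < mdist (c1 0) q ->
  mdist (c1 t) (c t) <= K -> mdist (c1 0) (c 0) <= L ->
  D = mdist (c 0) q ->
  fraction_point (t / D) (c 0) q m -> mdist m (c t) < 1 ->
  exists2 x, fraction_point (r / mdist (c1 0) q) (c1 0) q x &
    mdist x (c1 r) <= r / t * (2 * (K + 1 + L)).
Proof.
move=> r0 rt t0 tD tE K_bound L_bound DE hm mc.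
set z := c1 0; set E := mdist z q; have E0 : 0 < E by apply: lt_trans tE.
have D0 : 0 < D by apply: lt_trans tD.
have tD01 : 0 <= t / D <= 1 by apply: div_itv01; lra.
have tE01 : 0 <= t / E <= 1 by apply: div_itv01; rewrite // (ltW t0) ltW.
have rE01 : 0 <= r / E <= 1.
  by apply: div_itv01; rewrite // (ltW r0) (le_trans rt) ?ltW.
have rt01 : 0 <= r / t <= 1 by apply: div_itv01; lra.
have [m2 hm2] := cn z q tD01.
have mm2 : mdist m m2 <= L.
  have tD01' : 0 <= 1 - t / D <= 1 by lra.
  apply: (le_trans (fraction_points_cone tD01' (fraction_point_sym hm)
    (fraction_point_sym hm2))).
  rewrite metric_sym; apply: (le_trans _ L_bound).
  by rewrite ler_piMl ?mdist_ge0//; lra.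
have c1m2 : mdist (c1 t) m2 <= K + 1 + L.
  have h1 := metric_triangle (c1 t) (c t) m2.
  have := metric_triangle (c t) m m2; rewrite (metric_sym (c t) m); lra.
have zc1 u : 0 <= u -> mdist z (c1 u) = u.
  by move=> u0; rewrite ray_isometric// sub0r normrN ger0_norm.
have [s hs] := cn z q tE01.
have [zs sp] := fraction_point_dist tE01 hs.
have {}zs : mdist z s = t by rewrite zs divfK ?gt_eqF.
have [zm2 _] := fraction_point_dist tD01 hm2.
have sm2 : mdist s m2 <= K + 1 + L.
  rewrite (fraction_points_same_side tE01 tD01 hs hm2).
  rewrite -/E -(gtr0_norm E0) -normrM (gtr0_norm E0) mulrBl divfK ?gt_eqF//.
  apply: le_trans c1m2; rewrite -zm2 ler_norml.
  have h1 := metric_triangle z m2 (c1 t); have h2 := metric_triangle z (c1 t) m2.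
  rewrite (metric_sym m2) (zc1 t (ltW t0)) in h1; rewrite (zc1 t (ltW t0)) in h2.
  by apply/andP; split; lra.
have c1s : mdist s (c1 t) <= 2 * (K + 1 + L).
  by have := metric_triangle s m2 (c1 t); rewrite (metric_sym m2); lra.
have [x hx] := cn z q rE01; exists x => //.
have [zx xp] := fraction_point_dist rE01 hx.
have {}zx : mdist z x = r by rewrite zx divfK ?gt_eqF.
have xs : mdist x s = t - r.
  rewrite (fraction_points_same_side rE01 tE01 hx hs).
  rewrite -/E -(gtr0_norm E0) -normrM (gtr0_norm E0) mulrBl !divfK ?gt_eqF//.
  by rewrite ler0_norm ?subr_le0// opprB.
have fx : fraction_point (r / t) z s x.
  apply: fraction_pointI => //; rewrite zs.
    by rewrite zx divfK ?gt_eqF.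
  by rewrite xs mulrBl mul1r divfK ?gt_eqF.
have fc1 : fraction_point (r / t) z (c1 t) (c1 r).
  apply: fraction_pointI => //; rewrite (zc1 t (ltW t0)).
    by rewrite (zc1 r (ltW r0)) divfK ?gt_eqF.
  rewrite (ray_isometric c1 (ltW r0) (ltW t0)).
  by rewrite ler0_norm ?subr_le0// mulrBl mul1r
    divfK ?gt_eqF// opprB.
apply: (le_trans (fraction_points_cone rt01 fx fc1)).
by apply: ler_wpM2l => //; case/andP: rt01.
Qed.

(** Convergence of the segments from one base point implies convergence in the cone
    topology, whose neighbourhoods use all base points: [asymptotic_rays_close]
    is applied with [t] so large that its bound is below the allowed error. *)
Lemma segments_converge_cvg p c : segments_converge p c ->
  interior_point (p i) @[i --> \oo] --> ideal_point (endpoint c).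
Proof.
move=> pc; apply: cvg_ideal_point => c' r e r0 e0 [c1 [/endpointP[K cK] c10 cr]].
set L := mdist (c1 0) (c 0); have L0 : 0 <= L by exact: mdist_ge0.
have K0 : 0 <= K by apply: le_trans (cK 0 _); rewrite ?mdist_ge0.
pose e' := e - mdist (c1 r) (c' r); have e'0 : 0 < e' by rewrite subr_gt0.
pose B := 2 * (K + 1 + L); have B0 : 0 < B by rewrite /B; lra.
(* this value of [t] makes [r / t * B] equal to [e' * B / (B + e')] *)
pose t := r * (B + e') / e'.
have tE : r / t * B < e'.
  have -> : r / t * B = e' * B / (B + e').
    rewrite /t; field; rewrite !gt_eqF//; lra.
  by rewrite ltr_pdivrMr ?ltr_pM2l//; lra.
have rt : r <= t by rewrite ler_pdivlMr// ler_pM2l//; lra.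
have t0 : 0 < t by exact: lt_le_trans rt.
have tL0 : 0 < t + L by lra.
near=> i.
have [tD [m hm mc]] : t < mdist (c 0) (p i) /\
    exists2 m, fraction_point (t / mdist (c 0) (p i)) (c 0) (p i) m &
               mdist m (c t) < 1.
  by near: i; exact: pc.
have [tLD _] : t + L < mdist (c 0) (p i) /\
    exists2 m, fraction_point ((t + L) / mdist (c 0) (p i)) (c 0) (p i) m &
               mdist m (c (t + L)) < 1.
  by near: i; exact: pc.
have tz : t < mdist (c1 0) (p i).
  have := metric_triangle (c 0) (c1 0) (p i).
  by rewrite (metric_sym (c 0) (c1 0)) -/L; lra.
have [x hx xr] := asymptotic_rays_close r0 rt t0 tD tz (cK t (ltW t0)) (lexx L)
  erefl hm mc.
rewrite /cone_nbhd/= -c10; have rz : r < mdist (c1 0) (p i) by exact: le_lt_trans tz.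
split=> //.
have [||s gs sr] := geodesic_from_fraction_point cn _ _ hx.
- by rewrite !ltW.
- exact: lt_trans rz.
exists s => //; rewrite sr.
have := metric_triangle x (c1 r) (c' r); move: xr; rewrite -/B /e' in tE *.
lra.
Unshelve. all: by end_near. Qed.

End ConeTopology.

Section Subsequence.
Context {R : realType} {X : metricType R}.

Lemma ultra_compact_cvg (T : Type) (F : set_system T) (f : T -> X) (K : set X) :
  UltraFilter F -> compact K -> F (f @^-1` K) -> exists l : X, f @ F --> l.
Proof.
move=> FU cK FK; have [l [Kl cl]] := cK (f @ F) _ FK; exists l => A Al.
have [//|FnA] := in_ultra_setVsetC (f @^-1` A) FU.
by have [x []] := cl (~` A) A FnA Al.
Qed.

(** Closed balls being compact, an ultrafilter on the indices makes the segments
    converge pointwise, and the limit [c] is a ray. No diagonal argument is needed: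
    if the [N]-th selected segment is 1-close to [c] at time [N + 1], then by
    convexity it is [r / (N + 1)]-close to [c] at every earlier time [r]. *)
Lemma segments_subconverge (x0 : X) (p : nat -> X) :
  CN_inequality X -> proper_space X ->
  (forall r, \forall i \near \oo, r < mdist x0 (p i)) ->
  exists (phi : nat -> nat) (c : ray X),
    [/\ forall N, (N <= phi N)%N, c 0 = x0 & segments_converge (p \o phi) c].
Proof.
move=> cn proper pinf.
have [F [FU sF]] := ultraFilterLemma (_ : ProperFilter (\oo : set_system nat)).
have /choice[s gs] : forall i, exists s, geodesic s x0 (p i).
  by move=> i; exact: CN_geodesic_space.
have Fs r : F [set i | r < mdist x0 (p i)] by apply: sF; exact: pinf.
have /choice[c sc] : forall r, exists l : X, 0 <= r -> s i r @[i --> F] --> l.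
  move=> r; have [r0|r0] := boolP (0 <= r); last by exists x0.
  have [|l sl] := @ultra_compact_cvg _ F (fun i => s i r) _ FU (proper x0 r).
    apply: filterS (Fs r) => i /= /ltW ri.
    have rD : 0 <= r <= mdist x0 (p i) by rewrite r0.
    by have [-> _] := geodesic_dist rD (gs i).
  by exists l.
have c_iso u v : 0 <= u -> 0 <= v -> mdist (c u) (c v) = `|u - v|.
  move=> u0 v0.
  have close e : 0 < e -> exists i, [/\ mdist (s i u) (s i v) = `|u - v|,
      mdist (c u) (s i u) < e & mdist (c v) (s i v) < e].
    move=> e0; have /cvgrPdist_lt/(_ _ e0) h1 := sc u u0.
    have /cvgrPdist_lt/(_ _ e0) h2 := sc v v0.
    have [i [[[ui vi] ?] ?]] :=
      filter_ex (filterI (filterI (filterI (Fs u) (Fs v)) h1) h2).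
    have [_ _ si] := gs i; exists i; split=> //.
    by rewrite si// in_itv/= ?u0 ?v0/= ltW.
  apply/eqP; rewrite eq_le; apply/andP; split; apply/ler_addgt0Pl => e e0;
    have e20 : 0 < e / 2 by rewrite divr_gt0.
    have [i [<- h1 h2]] := close _ e20.
    have := metric_triangle (c u) (s i u) (c v).
    have := metric_triangle (s i u) (s i v) (c v).
    by rewrite (metric_sym (s i v) (c v)); lra.
  have [i [<- h1 h2]] := close _ e20.
  have := metric_triangle (s i u) (c u) (s i v).
  have := metric_triangle (c u) (c v) (s i v).
  by rewrite (metric_sym (s i u) (c u)); lra.
have c00 : c 0 = x0.
  apply/esym/mdist_positivity/eqP; rewrite eq_le mdist_ge0 andbT.
  apply/ler_addgt0Pl => e e0; rewrite addr0.
  have /cvgrPdist_lt/(_ _ e0) h1 := sc 0 (lexx 0).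
  have [i /ltW] := filter_ex h1.
  by have [-> _ _] := gs i; rewrite metric_sym.
have /choice[phi hphi] : forall N : nat, exists i, [/\ (N <= i)%N,
    N.+1%:R < mdist x0 (p i) & mdist (s i N.+1%:R) (c N.+1%:R) < 1].
  move=> N; have /cvgrPdist_lt/(_ _ ltr01) h1 := sc N.+1%:R (ler0n _ _).
  have h2 : F [set i | (N <= i)%N] by apply: sF; exact: nbhs_infty_ge.
  have [i [[? ?] ?]] := filter_ex (filterI (filterI h2 (Fs N.+1%:R)) h1).
  by exists i; split=> //; rewrite metric_sym.
exists phi, (Ray c_iso); split=> //=; first by move=> N; have [] := hphi N.
move=> r e r0 e0; rewrite /= c00; near=> N.
have [_ N1 sN] := hphi N; set D := mdist x0 (p (phi N)) in N1 *.
have N0 : 0 < N.+1%:R :> R by rewrite ltr0n.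
have rN : r <= N.+1%:R.
  apply: (le_trans (_ : _ <= N%:R)); last by rewrite ler_nat.
  by near: N; exact: nbhs_infty_ger.
have reN : r / e <= N%:R by near: N; exact: nbhs_infty_ger.
have D0 : 0 < D by exact: lt_trans N1.
have rD : r < D by exact: le_lt_trans N1.
split=> //; exists (s (phi N) r).
  by apply: geodesic_fraction_point_div; rewrite // !ltW.
have gN := gs (phi N).
have ND : 0 <= (N.+1%:R : R) <= D by rewrite (ltW N0) (ltW N1).
have rD' : 0 <= r <= D by rewrite (ltW r0) (ltW rD).
have [xN _] := geodesic_dist ND gN.
have [xr _] := geodesic_dist rD' gN.
have cc u v : 0 <= u <= v -> mdist (c u) (c v) = v - u.
  move=> /andP[u0 uv]; rewrite c_iso ?(le_trans u0)// ler0_norm ?subr_le0//.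
  by rewrite opprB.
have rN01 : 0 <= r / N.+1%:R <= 1 by apply: div_itv01; rewrite // (ltW r0).
have h1 : fraction_point (r / N.+1%:R) x0 (s (phi N) N.+1%:R) (s (phi N) r).
  apply: fraction_pointI => //; rewrite xN.
    by rewrite xr divfK ?gt_eqF.
  have [_ _ si] := gN; rewrite si ?in_itv//=.
  by rewrite ler0_norm ?subr_le0// mulrBl mul1r divfK ?gt_eqF// opprB.
have h2 : fraction_point (r / N.+1%:R) x0 (c N.+1%:R) (c r).
  have [r0' N0'] := (ltW r0, ltW N0).
  have c0u u : 0 <= u -> mdist x0 (c u) = u.
    by move=> u0; rewrite -c00 cc ?lexx// subr0.
  apply: fraction_pointI => //; rewrite !c0u ?cc ?r0'// ?divfK ?gt_eqF//.
  by rewrite mulrBl mul1r divfK ?gt_eqF.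
apply: (le_lt_trans (fraction_points_cone rN01 h1 h2)).
have rN_gt0 : 0 < r / N.+1%:R by rewrite divr_gt0.
apply: (lt_le_trans (_ : _ < r / N.+1%:R)).
  by rewrite -[ltRHS]mulr1 ltr_pM2l.
rewrite ler_pdivrMr// mulrC -ler_pdivrMr//; apply: (le_trans reN).
by rewrite ler_nat.
Unshelve. all: by end_near. Qed.

End Subsequence.
(** * Products *)

Section ProperUltra.
Context {R : realType} {X : metricType R}.

Lemma proper_ultra : (forall (x : X) (r : R) (F : set_system X), UltraFilter F ->
    F [set y | mdist x y <= r] -> exists l : X, F --> l) -> proper_space X.
Proof.
move=> cvg x r; rewrite compact_ultra => F FU FB.
have [l Fl] := cvg x r F FU FB; exists l; split=> //=.
apply/ler_addgt0Pl => e e0; have /fcvgrPdist_lt/(_ _ e0) h := Fl.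
have [y [xy ly]] := filter_ex (filterI FB h).
by have := metric_triangle x y l; rewrite (metric_sym y l) /= in xy ly *; lra.
Qed.

End ProperUltra.

(** A copy of the product type, carrying the Euclidean product metric instead of
    the maximum metric. *)
Definition l2prod (R : realType) (X Y : metricType R) : Type := (X * Y)%type.

Section L2Product.
Context {R : realType} {X Y : metricType R}.
Implicit Types p q r m : l2prod X Y.

Definition l2dist p q : R :=
  Num.sqrt (mdist p.1 q.1 ^+ 2 + mdist p.2 q.2 ^+ 2).

Lemma l2dist_ge0 p q : 0 <= l2dist p q.
Proof. exact: sqrtr_ge0. Qed.

Lemma l2dist_sqr p q : l2dist p q ^+ 2 = mdist p.1 q.1 ^+ 2 + mdist p.2 q.2 ^+ 2.
Proof. by rewrite sqr_sqrtr// addr_ge0 ?sqr_ge0. Qed.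

Lemma l2dist_le p q (e : R) : 0 <= e ->
  mdist p.1 q.1 ^+ 2 + mdist p.2 q.2 ^+ 2 <= e ^+ 2 -> l2dist p q <= e.
Proof. by move=> e0 h; apply: le_of_sqr; rewrite // l2dist_sqr. Qed.

Lemma l2distxx p : l2dist p p = 0.
Proof. by rewrite /l2dist !mdistxx expr0n/= addr0 sqrtr0. Qed.

Lemma l2dist_sym p q : l2dist p q = l2dist q p.
Proof. by rewrite /l2dist (metric_sym p.1) (metric_sym p.2). Qed.

Lemma l2dist_fst p q : mdist p.1 q.1 <= l2dist p q.
Proof.
by apply: le_of_sqr; rewrite ?l2dist_ge0// l2dist_sqr lerDl sqr_ge0.
Qed.

Lemma l2dist_snd p q : mdist p.2 q.2 <= l2dist p q.
Proof.
by apply: le_of_sqr; rewrite ?l2dist_ge0// l2dist_sqr lerDr sqr_ge0.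
Qed.

Lemma l2dist_positivity p q : l2dist p q = 0 -> p = q.
Proof.
move=> pq0; have := l2dist_fst p q; have := l2dist_snd p q.
have zero (Z : metricType R) (x y : Z) : mdist x y <= 0 -> x = y.
  by move=> xy; apply: mdist_positivity; apply/eqP; rewrite eq_le xy mdist_ge0.
by rewrite pq0 => /zero + /zero; case: p q {pq0} => [x y] [x' y'] /= -> ->.
Qed.

Lemma l2dist_triangle q p r : l2dist p r <= l2dist p q + l2dist q r.
Proof.
apply: l2dist_le; first by rewrite addr_ge0 ?l2dist_ge0.
have h1 : mdist p.1 r.1 ^+ 2 <= (mdist p.1 q.1 + mdist q.1 r.1) ^+ 2.
  by rewrite lerXn2r ?nnegrE ?addr_ge0 ?mdist_ge0// metric_triangle.
have h2 : mdist p.2 r.2 ^+ 2 <= (mdist p.2 q.2 + mdist q.2 r.2) ^+ 2.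
  by rewrite lerXn2r ?nnegrE ?addr_ge0 ?mdist_ge0// metric_triangle.
apply: (le_trans (lerD h1 h2)); rewrite [leRHS]sqrrD !l2dist_sqr.
set a := mdist p.1 q.1; set b := mdist q.1 r.1.
set c := mdist p.2 q.2; set d := mdist q.2 r.2.
suff : a * b + c * d <= l2dist p q * l2dist q r by lra.
apply: le_of_sqr; first by rewrite mulr_ge0 ?l2dist_ge0.
rewrite exprMn !l2dist_sqr -/a -/b -/c -/d.
have : 0 <= (a * d - c * b) ^+ 2 by exact: sqr_ge0.
by lra.
Qed.

HB.instance Definition _ := Choice.copy (l2prod X Y) (X * Y)%type.
HB.instance Definition _ := @isMetric.Build R (l2prod X Y) l2dist
  l2distxx l2dist_positivity l2dist_sym l2dist_triangle.

Lemma fraction_point_prod (t : R) p q m :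
  fraction_point t p.1 q.1 m.1 -> fraction_point t p.2 q.2 m.2 ->
  fraction_point t p q m.
Proof.
move=> h1 h2 r; rewrite !l2dist_sqr.
by have := h1 r.1; have := h2 r.2; lra.
Qed.

(** The CN inequality is additive in the squared distances. *)
Lemma CN_prod : CN_inequality X -> CN_inequality Y -> CN_inequality (l2prod X Y).
Proof.
move=> cnX cnY t p q t01; have [x hx] := cnX t p.1 q.1 t01.
have [y hy] := cnY t p.2 q.2 t01; exists (x, y).
exact: fraction_point_prod.
Qed.

Lemma fraction_point_components (t : R) p q m :
  CN_inequality X -> CN_inequality Y -> 0 <= t <= 1 ->
  fraction_point t p q m ->
  fraction_point t p.1 q.1 m.1 /\ fraction_point t p.2 q.2 m.2.
Proof.
move=> cnX cnY t01 hm; have [x hx] := cnX t p.1 q.1 t01.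
have [y hy] := cnY t p.2 q.2 t01.
have hxy : fraction_point t p q (x, y) by exact: fraction_point_prod.
have [h1 h2] := fraction_point_dist t01 hm.
have -> // : m = (x, y).
by apply: (fraction_point_unique t01 hxy); rewrite ?h1 ?h2.
Qed.

Lemma proper_prod : proper_space X -> proper_space Y -> proper_space (l2prod X Y).
Proof.
move=> pX pY; apply: proper_ultra => x r F FU FB.
have [|l1 h1] := @ultra_compact_cvg _ _ _ F fst _ FU (pX x.1 r).
  by apply: filterS FB => y /=; apply: le_trans; exact: l2dist_fst.
have [|l2 h2] := @ultra_compact_cvg _ _ _ F snd _ FU (pY x.2 r).
  by apply: filterS FB => y /=; apply: le_trans; exact: l2dist_snd.
exists (l1, l2); apply/fcvgrPdist_lt => e e0.
have e20 : 0 < e / 2 by rewrite divr_gt0.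
have /cvgrPdist_lt/(_ _ e20) {}h1 := h1.
have /cvgrPdist_lt/(_ _ e20) {}h2 := h2.
apply: filterS2 h1 h2 => y h1 h2.
apply: le_lt_trans (_ : mdist l1 y.1 + mdist l2 y.2 < e); last lra.
have d1 := mdist_ge0 l1 y.1; have d2 := mdist_ge0 l2 y.2.
apply: l2dist_le; first by rewrite addr_ge0.
by rewrite sqrrD/= [leRHS]addrAC lerDl mulrn_wge0// mulr_ge0.
Qed.

Lemma CAT0_prod : CAT0_space X -> CAT0_space Y -> CAT0_space (l2prod X Y).
Proof.
move=> [[x _] pX gX cX] [[y _] pY gY cY].
have cn := CN_prod (CAT0_CN gX cX) (CAT0_CN gY cY).
split; first by exists (x, y).
- exact: proper_prod.
- exact: CN_geodesic_space.
- exact: CN_CAT0_inequality.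
Qed.

End L2Product.
(** * The tree spanned by a four-point metric *)

Local Open Scope quotient_scope.

(** Spaces that embed in a tree: of the three ways to split four points into two
    pairs, the two with the larger sums of distances have equal sums. With two of the
    points equal, this gives the triangle inequality. Distinct vertices may be at
    distance 0. *)
Record fourpoint_space (R : realType) := FourpointSpace {
  vertex :> Type ;
  vdist : vertex -> vertex -> R ;
  vdistxx : forall x, vdist x x = 0 ;
  vdist_sym : forall x y, vdist x y = vdist y x ;
  fourpoint : forall x y z w,
    vdist x y + vdist z w <=
      Num.max (vdist x z + vdist y w) (vdist x w + vdist y z)
}.

Section Positions.
Context {R : realType} {V : fourpoint_space R}.
Local Notation d := (@vdist R V).

(** A point of the segment between the two vertices [endv true] and [endv false] of
    the tree to be built, at distance [depth b] from [endv b]. *)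
Record position := Position {
  endv : bool -> V ;
  depth : bool -> R ;
  depth_ge0 : forall b, 0 <= depth b ;
  depth_sum : depth true + depth false = d (endv true) (endv false)
}.

HB.instance Definition _ := gen_eqMixin position.
HB.instance Definition _ := gen_choiceMixin position.

Implicit Types (p q r : position) (b : bool).

Lemma depth_sumN p b : depth p b + depth p (~~ b) = d (endv p b) (endv p (~~ b)).
Proof. by case: b; rewrite /= ?depth_sum// addrC depth_sum vdist_sym. Qed.

(** In a tree, two points on segments are at distance [gap p q b b'] as soon as the
    path from [endv p b] to [endv q b'] runs through [p] and then [q]; otherwise [gap]
    underestimates their distance. Hence the maximum in [pdist]. *)
Definition gap p q b b' : R := d (endv p b) (endv q b') - depth p b - depth q b'.

Definition pdist p q : R :=
  Num.max (Num.max (gap p q true true) (gap p q true false))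
          (Num.max (gap p q false true) (gap p q false false)).

Lemma gap_le p q b b' : gap p q b b' <= pdist p q.
Proof. by rewrite /pdist !le_max; case: b; case: b'; rewrite lexx ?orbT. Qed.

Lemma gap_attained p q : exists b b', pdist p q = gap p q b b'.
Proof.
by rewrite /pdist; do 3?[case: leP => _]; do ?[by exists true, true];
  do ?[by exists true, false]; do ?[by exists false, true]; exists false, false.
Qed.

Lemma pdist_le p q (e : R) : (forall b b', gap p q b b' <= e) -> pdist p q <= e.
Proof. by move=> h; have [b [b' ->]] := gap_attained p q. Qed.

Lemma pdist_sym p q : pdist p q = pdist q p.
Proof.
by apply/eqP; rewrite eq_le; apply/andP; split; apply: pdist_le => b b';
  apply: le_trans (gap_le _ _ b' b); rewrite /gap vdist_sym addrAC.
Qed.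

Lemma pdistxx p : pdist p p = 0.
Proof.
apply/eqP; rewrite eq_le; apply/andP; split; last first.
  apply: le_trans (gap_le p p true false).
  by rewrite /gap; have := depth_sum p; lra.
apply: pdist_le => b b'; rewrite /gap.
have := depth_ge0 p b; have := depth_ge0 p b'.
have [->|nbb'] := eqVneq b' b; first by rewrite vdistxx; lra.
have -> : b' = ~~ b by case: b b' nbb' => -[].
by have := depth_sumN p b; lra.
Qed.

(** The four-point condition for one end of [p], one end of [r] and both ends of [q]
    is the triangle inequality. *)
Lemma pdist_triangle q p r : pdist p r <= pdist p q + pdist q r.
Proof.
apply: pdist_le => b b'.
have := fourpoint (endv p b) (endv r b') (endv q true) (endv q false).
have h1 := gap_le p q b true; have h2 := gap_le p q b false.
have h3 := gap_le q r true b'; have h4 := gap_le q r false b'.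
have h5 := depth_sum q; rewrite /gap in h1 h2 h3 h4 *.
rewrite (vdist_sym (endv r b')) (vdist_sym (endv r b')) le_max => /orP[]; lra.
Qed.

Lemma pdist_ge0 p q : 0 <= pdist p q.
Proof. by have := pdist_triangle q p p; rewrite pdistxx (pdist_sym q p); lra. Qed.

Lemma coincide_refl : reflexive (fun p q => pdist p q == 0).
Proof. by move=> p; rewrite pdistxx eqxx. Qed.

Lemma coincide_sym : symmetric (fun p q => pdist p q == 0).
Proof. by move=> p q; rewrite pdist_sym. Qed.

Lemma coincide_trans : transitive (fun p q => pdist p q == 0).
Proof.
move=> q p r /eqP pq /eqP qr; rewrite eq_le pdist_ge0 andbT.
by have := pdist_triangle q p r; rewrite pq qr addr0.
Qed.

Definition coincide := EquivRel _ coincide_refl coincide_sym coincide_trans.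

End Positions.

Arguments position {R} V.

(** Positions on different segments may denote the same point of the tree. *)
Definition tree_hull (R : realType) (V : fourpoint_space R) : Type :=
  {eq_quot (@coincide R V)}.

Section TreeHull.
Context {R : realType} {V : fourpoint_space R}.
Local Notation d := (@vdist R V).
Local Notation T := (tree_hull V).

HB.instance Definition _ := Choice.copy T {eq_quot (@coincide R V)}.

Definition at_position (p : position V) : T := \pi_{eq_quot (@coincide R V)} p.
Definition position_of (a : T) : position V := repr (a : {eq_quot (@coincide R V)}).

Lemma position_ofK a : at_position (position_of a) = a.
Proof. exact: reprK. Qed.

Lemma at_position_eq p q : at_position p = at_position q <-> pdist p q = 0.
Proof. by split=> [/eqmodP/eqP//|pq]; apply/eqmodP; apply/eqP. Qed.

Definition tdist (a b : T) : R := pdist (position_of a) (position_of b).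

Lemma tdistE p q : tdist (at_position p) (at_position q) = pdist p q.
Proof.
have coincide_dist p1 p2 q1 q2 : pdist p1 p2 = 0 -> pdist q1 q2 = 0 ->
    pdist p1 q1 <= pdist p2 q2.
  move=> p12 q12; have := pdist_triangle p2 p1 q1.
  by have := pdist_triangle q2 p2 q1; rewrite (pdist_sym q2); lra.
have pos r : pdist (position_of (at_position r)) r = 0.
  by apply/at_position_eq; rewrite position_ofK.
apply/eqP; rewrite eq_le /tdist; apply/andP; split; apply: coincide_dist;
  by rewrite ?pos// pdist_sym pos.
Qed.

Lemma tdistxx a : tdist a a = 0.
Proof. exact: pdistxx. Qed.

Lemma tdist_positivity a b : tdist a b = 0 -> a = b.
Proof. by move=> /at_position_eq; rewrite !position_ofK. Qed.

Lemma tdist_sym a b : tdist a b = tdist b a.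
Proof. exact: pdist_sym. Qed.

Lemma tdist_triangle b a c : tdist a c <= tdist a b + tdist b c.
Proof. exact: pdist_triangle. Qed.

HB.instance Definition _ := @isMetric.Build R T tdist
  tdistxx tdist_positivity tdist_sym tdist_triangle.

Lemma mdist_tree p q : mdist (at_position p) (at_position q) = pdist p q.
Proof. exact: tdistE. Qed.

Lemma segment_depth_ge0 (s u : R) : 0 <= s -> 0 <= u ->
  forall b : bool, 0 <= (if b then s else u).
Proof. by move=> s0 u0 []. Qed.

Definition on_segment (x y : V) (s u : R) (s0 : 0 <= s) (u0 : 0 <= u)
    (su : s + u = d x y) : position V :=
  @Position R V (fun b => if b then x else y) (fun b => if b then s else u)
    (segment_depth_ge0 s0 u0) su.

Lemma vdist0E (x : V) : 0 + 0 = d x x.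
Proof. by rewrite addr0 vdistxx. Qed.

Definition at_vertex (x : V) : T :=
  at_position (on_segment (lexx 0) (lexx 0) (vdist0E x)).

Lemma mdist_vertex x y : mdist (at_vertex x) (at_vertex y) = d x y.
Proof.
by rewrite mdist_tree /pdist /gap/= !subr0 !maxxx.
Qed.

(** Let the distance between [p] and [q] be attained by the ends [x] of [p] and [z] of
    [q], so that [p] and [q] both lie on the segment [x z], as does the point [m] to be
    found. Since the distance from [r] to [m] is a gap at [x] or at [z], the path from
    [r] to [p] or the path from [r] to [q] runs through [m]. The inequality then
    reduces to an identity on a line. *)
Lemma CN_tree_hull : CN_inequality T.
Proof.
move=> t a c /andP[t0 t1]; rewrite -(position_ofK a) -(position_ofK c).
set p := position_of a; set q := position_of c.
have [b [b' pq]] := gap_attained p q.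
set D := pdist p q in pq *; have D0 : 0 <= D by exact: pdist_ge0.
have s0 : 0 <= depth p b + t * D by rewrite addr_ge0 ?depth_ge0 ?mulr_ge0.
have u0 : 0 <= depth q b' + (1 - t) * D.
  by rewrite addr_ge0 ?depth_ge0 ?mulr_ge0//; lra.
have su : depth p b + t * D + (depth q b' + (1 - t) * D) = d (endv p b) (endv q b').
  by move: pq; rewrite /gap; lra.
pose m := on_segment s0 u0 su; exists (at_position m) => r.
rewrite -(position_ofK r) !mdist_tree -/D; move: (position_of r) => {}r.
(* [m] is on the way from [r'] to [p] or on the way from [r'] to [q] *)
have front r' : pdist r' m <= pdist r' p - t * D \/
    pdist r' m <= pdist r' q - (1 - t) * D.
  have [b1 [b2 ->]] := gap_attained r' m; case: b2; [left|right]; rewrite /gap/=.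
    by have := gap_le r' p b1 b; rewrite /gap; lra.
  by have := gap_le r' q b1 b'; rewrite /gap; lra.
have pm : pdist m p <= t * D.
  have tD : 0 <= t * D by rewrite mulr_ge0.
  by rewrite pdist_sym; case: (front p); rewrite ?pdistxx -?/D; lra.
have qm : pdist m q <= (1 - t) * D.
  have tD : 0 <= (1 - t) * D by rewrite mulr_ge0//; lra.
  by rewrite pdist_sym; case: (front q); rewrite ?pdistxx ?(pdist_sym q p) -?/D; lra.
have pq_le := pdist_triangle m p q; rewrite -/D (pdist_sym p m) in pq_le.
have pmE : pdist m p = t * D by lra.
have qmE : pdist m q = (1 - t) * D by lra.
have far x : `|pdist r m - pdist m x| <= pdist r x.
  have h1 := pdist_triangle x r m; have h2 := pdist_triangle r m x.
  by rewrite (pdist_sym x m) (pdist_sym m r) in h1 h2; rewrite ler_norml; lra.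
have := far p; have := far q; rewrite pmE qmE.
set A := pdist r m; have A0 : 0 <= A := pdist_ge0 r m.
have key (e f B C : R) : 0 <= e -> 0 <= f -> e + f = 1 ->
    A + e * D <= B -> `|A - f * D| <= C ->
    A ^+ 2 <= f * B ^+ 2 + e * C ^+ 2 - e * f * D ^+ 2.
  move=> e0 f0 ef AB AC.
  have hB : (A + e * D) ^+ 2 <= B ^+ 2.
    by apply: lerXn2r; rewrite ?nnegrE// ?(le_trans _ AB)// addr_ge0// mulr_ge0.
  have hC : (A - f * D) ^+ 2 <= C ^+ 2.
    by rewrite -[leLHS]real_normK ?num_real// lerXn2r ?nnegrE// (le_trans _ AC).
  have := ler_wpM2l f0 hB; have := ler_wpM2l e0 hC.
  have -> : f = 1 - e by lra.
  suff -> : A ^+ 2 = (1 - e) * (A + e * D) ^+ 2 + e * (A - (1 - e) * D) ^+ 2 -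
    e * (1 - e) * D ^+ 2 by lra.
  by ring.
have t1' : 0 <= 1 - t by lra.
move=> farq farp; case: (front r) => h; rewrite -/A in h.
  by apply: key => //; lra.
have := @key (1 - t) t (pdist r q) (pdist r p) t1' t0.
by rewrite subrK => /(_ erefl) /(_ _ farp); lra.
Qed.

End TreeHull.
(** * Reduced words in a free group *)

Section ReducedWords.
Variable n : nat.
Local Notation letter := ('I_n * bool)%type.
Implicit Types (a b : letter) (w u v : seq letter).

(** The letter [(i, true)] stands for the [i]-th generator, [(i, false)] for its
   inverse. *)
Definition letter_inv a : letter := (a.1, ~~ a.2).

Lemma letter_invK : involutive letter_inv.
Proof. by case=> i b; rewrite /letter_inv/= negbK. Qed.

Definition noncancelling a b : bool := b != letter_inv a.

Definition reduced w : bool := sorted noncancelling w.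

Definition word_inv w := rev (map letter_inv w).

Lemma noncancelling_inv a b :
  noncancelling (letter_inv b) (letter_inv a) = noncancelling a b.
Proof.
by rewrite /noncancelling letter_invK eq_sym.
Qed.

Lemma reduced_inv w : reduced (word_inv w) = reduced w.
Proof.
rewrite /reduced /word_inv rev_sorted sorted_map.
by apply: eq_sorted => a b /=; rewrite noncancelling_inv.
Qed.

Lemma reduced_cons a w : reduced (a :: w) -> reduced w.
Proof. exact: path_sorted. Qed.

(** Left multiplication by a letter, on reduced words. *)
Definition push a w : seq letter :=
  if w is b :: w' then if b == letter_inv a then w' else a :: w else [:: a].

Lemma push_reduced a w : reduced w -> reduced (push a w).
Proof.
case: w => //= b w; case: eqP => [_|/eqP ba] rw; first exact: path_sorted rw.
by rewrite /reduced/= /noncancelling ba.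
Qed.

Lemma push_noncancelling a w : reduced (a :: w) -> push a w = a :: w.
Proof. by case: w => //= b w /andP[/negbTE]; rewrite /noncancelling => ->. Qed.

Lemma pushK a w : reduced w -> push (letter_inv a) (push a w) = w.
Proof.
case: w => [|b w] rw /=; first by rewrite letter_invK eqxx.
case: eqP => [ba|_] /=; last by rewrite letter_invK eqxx.
by rewrite -ba push_noncancelling.
Qed.

End ReducedWords.

Section NormalForm.
Variables (n : nat) (F : groupType) (x : 'I_n -> F).
Local Notation letter := ('I_n * bool)%type.
Implicit Types (a b : letter) (w u v : seq letter) (g h : F).

Definition letter_val a : F := if a.2 then x a.1 else (x a.1)^-1%g.

Definition word_val w : F := foldr (fun a g => (letter_val a * g)%g) 1%g w.

Lemma letter_val_inv a : letter_val (letter_inv a) = (letter_val a)^-1%g.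
Proof. by case: a => i []; rewrite /letter_val/= ?invgK. Qed.

Lemma word_val_cat u v : word_val (u ++ v) = (word_val u * word_val v)%g.
Proof. by elim: u => [|a u IH] /=; rewrite ?mul1g// IH mulgA. Qed.

Lemma word_val_inv w : word_val (word_inv w) = (word_val w)^-1%g.
Proof.
elim: w => [|a w IH] /=; first by rewrite invg1.
rewrite /word_inv/= rev_cons -cats1 word_val_cat -/(word_inv w) IH/= mulg1.
by rewrite letter_val_inv invgM.
Qed.

Lemma word_val_push a w : word_val (push a w) = (letter_val a * word_val w)%g.
Proof.
case: w => [|b w] //=; case: eqP => [->|//].
by rewrite letter_val_inv mulgA mulgV mul1g.
Qed.

Definition reduced_word := {w : seq letter | reduced w}.

(** Pairs of an element [g] of [F] and a permutation of the reduced words that lies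
    above left multiplication by [g]. They form a group, to which the universal
    property is applied: this yields an action of [F] on reduced words that
    is compatible with evaluation, without knowing beforehand that the generators
    generate [F]. *)
Record word_symmetry := WordSymmetry {
  ws_elt : F ;
  ws_fun : reduced_word -> reduced_word ;
  ws_inv : reduced_word -> reduced_word ;
  ws_funK : cancel ws_fun ws_inv ;
  ws_invK : cancel ws_inv ws_fun ;
  ws_val : forall w : reduced_word, word_val (val (ws_fun w)) = (ws_elt * word_val (val w))%g
}.

Lemma word_symmetry_eq (s t : word_symmetry) : ws_elt s = ws_elt t ->
  ws_fun s = ws_fun t -> ws_inv s = ws_inv t -> s = t.
Proof.
case: s t => [g p q pq qp pv] [h p' q' pq' qp' pv'] /= gh pp qq.
move: pq qp pv pq' qp' pv'; rewrite gh pp qq => *.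
by congr WordSymmetry; exact: Prop_irrelevance.
Qed.

HB.instance Definition _ := gen_eqMixin word_symmetry.
HB.instance Definition _ := gen_choiceMixin word_symmetry.

Lemma ws_one_val (w : reduced_word) : word_val (val w) = (1 * word_val (val w))%g.
Proof. by rewrite mul1g. Qed.

Definition ws_one : word_symmetry :=
  @WordSymmetry 1%g id id (fun=> erefl) (fun=> erefl) ws_one_val.

Lemma ws_mul_val (s t : word_symmetry) (w : reduced_word) :
  word_val (val (ws_fun s (ws_fun t w))) = (ws_elt s * ws_elt t * word_val (val w))%g.
Proof. by rewrite !ws_val mulgA. Qed.

Definition ws_mul (s t : word_symmetry) : word_symmetry :=
  @WordSymmetry (ws_elt s * ws_elt t)%g (ws_fun s \o ws_fun t)
    (ws_inv t \o ws_inv s) (can_comp (ws_funK s) (ws_funK t))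
    (can_comp (ws_invK t) (ws_invK s)) (ws_mul_val s t).

Lemma ws_opp_val (s : word_symmetry) (w : reduced_word) :
  word_val (val (ws_inv s w)) = ((ws_elt s)^-1 * word_val (val w))%g.
Proof. by rewrite -{2}(ws_invK s w) ws_val mulgA mulVg mul1g. Qed.

Definition ws_opp (s : word_symmetry) : word_symmetry :=
  WordSymmetry (ws_invK s) (ws_funK s) (ws_opp_val s).

Lemma ws_mulA : associative ws_mul.
Proof. by move=> s t u; apply: word_symmetry_eq => //=; rewrite mulgA. Qed.

Lemma ws_mul1 : left_id ws_one ws_mul.
Proof. by move=> s; apply: word_symmetry_eq => //=; rewrite mul1g. Qed.

Lemma ws_1mul : right_id ws_one ws_mul.
Proof. by move=> s; apply: word_symmetry_eq => //=; rewrite mulg1. Qed.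

Lemma ws_mulN : left_inverse ws_one ws_opp ws_mul.
Proof.
move=> s; apply: word_symmetry_eq => /=; first by rewrite mulVg.
  by apply/funext => w /=; rewrite ws_funK.
by apply/funext => w /=; rewrite ws_funK.
Qed.

Lemma ws_Nmul : right_inverse ws_one ws_opp ws_mul.
Proof.
move=> s; apply: word_symmetry_eq => /=; first by rewrite mulgV.
  by apply/funext => w /=; rewrite ws_invK.
by apply/funext => w /=; rewrite ws_invK.
Qed.

HB.instance Definition _ := @isGroup.Build word_symmetry ws_one ws_opp ws_mul
  ws_mulA ws_mul1 ws_1mul ws_mulN ws_Nmul.

Definition push_word a (w : reduced_word) : reduced_word :=
  exist _ (push a (val w)) (push_reduced a (valP w)).

Lemma push_wordK a : cancel (push_word a) (push_word (letter_inv a)).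
Proof. by move=> w; apply: val_inj => /=; rewrite pushK// (valP w). Qed.

Lemma push_word_invK a : cancel (push_word (letter_inv a)) (push_word a).
Proof. by move=> w; rewrite -{2}(push_wordK (letter_inv a) w) letter_invK. Qed.

Definition push_symmetry a : word_symmetry :=
  WordSymmetry (push_wordK a) (push_word_invK a)
    (fun w : reduced_word => word_val_push a (val w)).

Hypothesis free : forall (K : groupType) (y : 'I_n -> K),
  exists! f : F -> K, {morph f : u v / (u * v)%g} /\ forall i, f (x i) = y i.

(** The normal form of [g] is the image of the empty word under the permutation
    attached to [g]. That the permutation lies above [g] itself follows from the
    uniqueness part of the universal property, applied to the identity of [F]. *)
Lemma normal_form_exists : exists nf : F -> seq letter,
  [/\ forall g, reduced (nf g), forall g, word_val (nf g) = g &
      forall w, reduced w -> nf (word_val w) = w].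
Proof.
have [f [[fM fx] _]] := free (fun i => push_symmetry (i, true)).
(* the first component of [f] is an endomorphism fixing the generators *)
have felt g : ws_elt (f g) = g.
  have [k [_ uniq]] := free x.
  have kE : k = fun h => ws_elt (f h).
    by apply: uniq; split=> [u v|i]; rewrite ?fM ?fx.
  by rewrite -[ws_elt _]/((fun h => ws_elt (f h)) g) -kE (uniq id).
have f1 : f 1%g = 1%g by apply: (mulgI (f 1%g)); rewrite -fM !mulg1.
have fV g : f g^-1%g = (f g)^-1%g.
  by apply: (mulgI (f g)); rewrite -fM !mulgV.
have fletter a : ws_fun (f (letter_val a)) = push_word a.
  case: a => i [] /=; rewrite /letter_val/= ?fV fx//.
pose e : reduced_word := exist _ [::] isT.
exists (fun g => val (ws_fun (f g) e)); split=> [g|g|w].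
- exact: valP.
- by rewrite ws_val /= mulg1 felt.
- elim: w => [|a w IH] rw /=; first by rewrite f1.
  rewrite fM /= fletter /= IH ?push_noncancelling//; exact: reduced_cons rw.
Qed.

End NormalForm.
(** * Weighted word metrics *)

Section WeightedLength.
Context {R : realType} {n : nat} (ell : 'I_n -> R) (ell_gt0 : forall i, 0 < ell i).
Local Notation letter := ('I_n * bool)%type.
Implicit Types (a b : letter) (w u v : seq letter).

Definition weight w : R := \sum_(a <- w) ell a.1.

Lemma weight_nil : weight [::] = 0. Proof. exact: big_nil. Qed.

Lemma weight_cons a w : weight (a :: w) = ell a.1 + weight w.
Proof. exact: big_cons. Qed.

Lemma weight_cat u v : weight (u ++ v) = weight u + weight v.
Proof. exact: big_cat. Qed.

Lemma weight_inv w : weight (word_inv w) = weight w.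
Proof. by rewrite /weight /word_inv (perm_big _ (permEl (perm_rev _)))/= big_map. Qed.

(** The weight of the longest common prefix, that is, the Gromov product of the two
    words based at the empty word. *)
Fixpoint common u v : R :=
  match u, v with
  | a :: u', b :: v' => if a == b then ell a.1 + common u' v' else 0
  | _, _ => 0
  end.

Lemma common_ge0 u v : 0 <= common u v.
Proof.
elim: u v => [|a u IH] [|b v] //=; case: eqP => // _.
by rewrite addr_ge0// ltW.
Qed.

Lemma common_sym u v : common u v = common v u.
Proof.
elim: u v => [|a u IH] [|b v] //=; rewrite (eq_sym b a).
by case: eqP => // ->; rewrite IH.
Qed.

Lemma common_ultrametric u v w :
  common u v <= common u w \/ common v w <= common u w.
Proof.
elim: v u w => [|b v IH] u w.
  by left; rewrite common_sym/= common_ge0.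
case: u => [|a u]; first by left.
case: w => [|c w] /=; first by right.
case: (eqVneq a b) => [->|ab]; last first.
  by left; case: eqP => // _; rewrite addr_ge0 ?common_ge0// ltW.
case: (eqVneq b c) => [->|bc]; last by right.
by case: (IH u w) => h; [left|right]; rewrite lerD2l.
Qed.

End WeightedLength.

Section FreeTree.
Context {R : realType} {n : nat} {F : groupType} {x : 'I_n -> F}.
Local Notation letter := ('I_n * bool)%type.
Implicit Types (a b : letter) (w u v : seq letter) (g h : F).

Context {nf : F -> seq letter} (nf_reduced : forall g, reduced (nf g))
  (nfK : forall g, word_val x (nf g) = g)
  (nf_val : forall w, reduced w -> nf (word_val x w) = w).
Context {ell : 'I_n -> R} (ell_ge1 : forall i, 1 <= ell i).

Local Lemma ell_gt0 i : 0 < ell i.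
Proof. exact: lt_le_trans (ell_ge1 i). Qed.

Definition word_dist g h : R := weight ell (nf (g^-1 * h)%g).

(** After cancelling the common prefix, the inverse of the first word followed by the
    second one is reduced. *)
Lemma word_dist_common g h :
  word_dist g h = weight ell (nf g) + weight ell (nf h) - 2 * common ell (nf g) (nf h).
Proof.
rewrite /word_dist -{1}(nfK g) -{1}(nfK h).
elim: (nf g) (nf h) (nf_reduced g) (nf_reduced h) => [|a u IH] v ru rv.
  by rewrite /= invg1 mul1g nf_val// weight_nil; lra.
case: v rv => [|b v] rv.
  by rewrite /= mulg1 -[(_ * _)%g]/(word_val x (a :: u)) -word_val_inv nf_val
    ?reduced_inv// weight_inv weight_nil; lra.
have [ab|ab] := eqVneq a b.
  rewrite -ab /= eqxx invgM -mulgA mulKg.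
  rewrite IH ?(reduced_cons ru) ?(reduced_cons rv)// !weight_cons; lra.
rewrite -word_val_inv -word_val_cat nf_val.
  by rewrite weight_cat weight_inv /= (negbTE ab); lra.
rewrite /word_inv/= rev_cons cat_rcons /reduced sorted_cat_cons.
have := ru; rewrite -reduced_inv /word_inv/= rev_cons /reduced => ->.
by rewrite /= /noncancelling letter_invK eq_sym ab.
Qed.

Lemma word_dist_trans k g h : word_dist (k * g)%g (k * h)%g = word_dist g h.
Proof. by rewrite /word_dist invgM -mulgA mulKg. Qed.

Lemma word_distxx g : word_dist g g = 0.
Proof. by rewrite word_dist_common; elim: (nf g) => [|a w IH]; rewrite /= ?eqxx ?weight_cons ?weight_nil; lra. Qed.

Lemma word_dist_sym g h : word_dist g h = word_dist h g.
Proof. by rewrite !word_dist_common common_sym; lra. Qed.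

Lemma nf1 : nf 1%g = [::].
Proof. exact: (@nf_val [::]). Qed.

(** Translating [g4] to 1 turns the four-point condition into the ultrametric
    inequality for common prefixes. *)
Lemma word_dist_fourpoint g1 g2 g3 g4 :
  word_dist g1 g2 + word_dist g3 g4 <=
  Num.max (word_dist g1 g3 + word_dist g2 g4) (word_dist g1 g4 + word_dist g2 g3).
Proof.
have tr g h : word_dist g h = word_dist (g4^-1 * g)%g (g4^-1 * h)%g.
  by rewrite word_dist_trans.
rewrite !(tr _ g4) (tr g1 g2) (tr g1 g3) (tr g2 g3) mulVg.
move: (_ * g1)%g (_ * g2)%g (_ * g3)%g => u v w.
have w1 g : word_dist g 1%g = weight ell (nf g).
  by rewrite word_dist_common nf1 weight_nil common_sym/=; lra.
rewrite !w1 !word_dist_common le_max; apply/orP.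
have := common_ultrametric ell_gt0 (nf u) (nf w) (nf v).
by rewrite (common_sym ell (nf w)) => -[h|h]; [left|right]; lra.
Qed.

Definition word_space : fourpoint_space R :=
  FourpointSpace word_distxx word_dist_sym word_dist_fourpoint.

End FreeTree.
(** * Geometric actions *)

Section ActionCriteria.
Context {R : realType} {G : groupType} {X : metricType R}.
Variable a : isometric_action G X.
Hypothesis proper : proper_space X.

Lemma proper_orbit (x : X) (r : R) :
  proper_action a -> finite_set [set g | mdist x (a g x) <= r].
Proof.
move=> pa; have := pa _ (@proper x r); apply: sub_finite_set => g /= gr.
exists (a g x); split=> //; exists x => //=.
by rewrite mdistxx; apply: le_trans gr; exact: mdist_ge0.
Qed.

Lemma compact_mdist_bounded (x : X) (K : set X) : compact K ->
  exists r, forall y, K y -> mdist x y <= r.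
Proof.
move=> /compact_near_coveringP cK.
have [|N _ hN] := cK nat \oo (fun i y => mdist x y <= i%:R) _; last first.
  by exists N%:R => y Ky; apply: (hN N) => //=.
move=> y Ky; near=> z i => /=.
have yz : mdist y z < 1.
  by near: z; apply: (cvgr_dist_lt (f := id) (F := nbhs y)); first exact: cvg_id.
have : mdist x y + 1 <= i%:R by near: i; exact: nbhs_infty_ger.
by have := metric_triangle x y z; lra.
Unshelve. all: by end_near. Qed.

Lemma orbit_proper (x : X) :
  (forall r, finite_set [set g | mdist x (a g x) <= r]) -> proper_action a.
Proof.
move=> fin K /(compact_mdist_bounded x)[r Kr].
apply: (sub_finite_set _ (fin (r + r))) => g [_ [[y Ky <-] Kgy]] /=.
have := metric_triangle x (a g y) (a g x).
by rewrite act_isometric (metric_sym y); have := Kr _ Ky; have := Kr _ Kgy; lra.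
Qed.

Lemma cocompact_orbit (x : X) : cocompact_action a ->
  exists r, forall y, exists g, mdist (a g x) y <= r.
Proof.
move=> [K /(compact_mdist_bounded x)[r Kr] cover]; exists r => y.
have : [set: X] y by []; rewrite -cover => -[g _ [z Kz <-]].
by exists g; rewrite act_isometric Kr.
Qed.

Lemma orbit_cocompact (x : X) (r : R) :
  (forall y, exists g, mdist (a g x) y <= r) -> cocompact_action a.
Proof.
move=> cover; exists [set y | mdist x y <= r]; first exact: proper.
rewrite predeqE => y; split=> // _; have [g gy] := cover y.
exists g => //; exists (a g^-1%g y); last by rewrite -actM mulgV act1.
by rewrite /= -(act_isometric a g) -actM mulgV act1.
Qed.

End ActionCriteria.

Section ProductAction.
Context {R : realType} {G H : groupType} {X Y : metricType R}.
Variables (a : isometric_action G X) (b : isometric_action H Y).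

Definition prod_act_fun (g : G * H) (p : l2prod X Y) : l2prod X Y :=
  (a g.1 p.1, b g.2 p.2).

Lemma prod_act1 p : prod_act_fun 1%g p = p.
Proof. by case: p => x y; rewrite /prod_act_fun/= !act1. Qed.

Lemma prod_actM g h p :
  prod_act_fun (g * h)%g p = prod_act_fun g (prod_act_fun h p).
Proof. by rewrite /prod_act_fun/= !actM. Qed.

Lemma prod_act_isometric g p q :
  mdist (prod_act_fun g p) (prod_act_fun g q) = mdist p q.
Proof.
rewrite -[LHS]/(l2dist _ _) -[RHS]/(l2dist _ _).
by rewrite /l2dist/= !act_isometric.
Qed.

Definition prod_action : isometric_action (G * H)%type (l2prod X Y) :=
  IsometricAction prod_act1 prod_actM prod_act_isometric.

Lemma prod_geometric : proper_space X -> proper_space Y ->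
  [set: X] !=set0 -> [set: Y] !=set0 ->
  geometric_action a -> geometric_action b -> geometric_action prod_action.
Proof.
move=> pX pY [x _] [y _] [pa ca] [pb cb]; split.
  apply: (@orbit_proper _ _ _ _ ((x, y) : l2prod X Y)) => r.
  apply: (sub_finite_set _ (finite_setX (proper_orbit pX x r pa)
    (proper_orbit pY y r pb))) => g /= gr; split => /=.
    exact: le_trans (@l2dist_fst _ _ _ (x, y) (a g.1 x, b g.2 y)) gr.
  exact: le_trans (@l2dist_snd _ _ _ (x, y) (a g.1 x, b g.2 y)) gr.
have [r hr] := cocompact_orbit x ca; have [s hs] := cocompact_orbit y cb.
apply: (@orbit_cocompact _ _ _ _ (proper_prod pX pY) (x, y) (r + s)) => -[x' y'].
have [g gx] := hr x'; have [h hy] := hs y'; exists (g, h).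
have d1 := mdist_ge0 (a g x) x'; have d2 := mdist_ge0 (b h y) y'.
have r0 : 0 <= r := le_trans d1 gx; have s0 : 0 <= s := le_trans d2 hy.
apply: l2dist_le => /=; first by rewrite addr_ge0.
have h1 : mdist (a g x) x' ^+ 2 <= r ^+ 2 by rewrite lerXn2r ?nnegrE.
have h2 : mdist (b h y) y' ^+ 2 <= s ^+ 2 by rewrite lerXn2r ?nnegrE.
have : 0 <= r * s by rewrite mulr_ge0.
by rewrite sqrrD; lra.
Qed.

End ProductAction.

Section Segments.
Context {R : realType} {V : fourpoint_space R}.
Local Notation d := (@vdist R V).
Local Notation T := (tree_hull V).
Implicit Types (x y v : V) (s t D : R).

Lemma vdist_ge0 x y : 0 <= d x y.
Proof. by rewrite -mdist_vertex mdist_ge0. Qed.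

(** Forces [s] into the interval [0, D], so that [segment_point] below is defined at
    all real numbers. *)
Definition clamp (D s : R) : R := Num.max 0 (Num.min s D).

Lemma clamp_ge0 D s : 0 <= clamp D s.
Proof. by rewrite le_max lexx. Qed.

Lemma clamp_le D s : 0 <= D -> 0 <= D - clamp D s.
Proof. by move=> D0; rewrite subr_ge0 ge_max D0 ge_min lexx orbT. Qed.

Lemma clamp_id D s : 0 <= s <= D -> clamp D s = s.
Proof. by move=> /andP[s0 sD]; rewrite /clamp min_l// max_r. Qed.

Definition segment_position x y s : position V :=
  on_segment (clamp_ge0 (d x y) s) (clamp_le s (vdist_ge0 x y)) (subrKC _ _).

Definition segment_point x y s : T := at_position (segment_position x y s).

Lemma segment_pointP (p : T) : exists x y s, 0 <= s <= d x y /\ p = segment_point x y s.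
Proof.
rewrite -(position_ofK p); move: (position_of p) => {}p.
have sD : 0 <= depth p true <= d (endv p true) (endv p false).
  by have := depth_sum p; have := depth_ge0 p true; have := depth_ge0 p false; lra.
exists (endv p true), (endv p false), (depth p true); split=> //.
apply/at_position_eq; rewrite -[RHS](pdistxx p) /pdist /gap/= !clamp_id//.
by have -> : d (endv p true) (endv p false) - depth p true = depth p false
  by rewrite -depth_sum addrAC subrr add0r.
Qed.

Lemma pdist_eq0 (p q : position V) : (forall b b', gap p q b b' <= 0) ->
  at_position p = at_position q.
Proof.
by move=> h; apply/at_position_eq/eqP; rewrite eq_le pdist_ge0 andbT pdist_le.
Qed.

(** The position on a segment is the same point of the tree when the segment is cut at
    a vertex [v] beyond it. *)
Lemma segment_point_prefix x y v s : d x y = d x v + d v y ->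
  0 <= s <= d x v -> segment_point x y s = segment_point x v s.
Proof.
move=> xvy /[dup] sv /andP[s0 s1]; have vy := vdist_ge0 v y.
apply: pdist_eq0 => b b'; rewrite /gap/= !clamp_id ?s0//=; last by lra.
by case: b; case: b'; rewrite ?vdistxx ?(vdist_sym y x) ?(vdist_sym y v); lra.
Qed.

Lemma segment_point_rev x y s : 0 <= s <= d x y ->
  segment_point x y s = segment_point y x (d x y - s).
Proof.
move=> sxy; have sxy' : 0 <= d x y - s <= d x y by lra.
apply: pdist_eq0 => b b'.
rewrite /gap/= (vdist_sym y x) !clamp_id//.
by case: b; case: b'; rewrite ?vdistxx ?(vdist_sym y x); lra.
Qed.

Lemma segment_point_suffix x y v s : d x y = d x v + d v y ->
  d x v <= s <= d x y -> segment_point x y s = segment_point v y (s - d x v).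
Proof.
move=> xvy sv; have xv := vdist_ge0 x v.
rewrite segment_point_rev; last lra.
rewrite (@segment_point_prefix _ _ v).
- rewrite segment_point_rev; last by rewrite (vdist_sym y v); lra.
  by congr segment_point; rewrite (vdist_sym y v); lra.
- by rewrite (vdist_sym y x) (vdist_sym y v) (vdist_sym v x); lra.
- by rewrite (vdist_sym y v); lra.
Qed.

Lemma mdist_vertex_segment x y s : 0 <= s <= d x y ->
  mdist (at_vertex x) (segment_point x y s) <= s.
Proof.
move=> sxy; rewrite mdist_tree; apply: pdist_le => b b'.
rewrite /gap/= clamp_id//.
by case: b; case: b'; rewrite ?vdistxx; lra.
Qed.

Lemma clamp_lipschitz D s t : 0 <= D -> `|clamp D s - clamp D t| <= `|s - t|.
Proof.
have key (u v : R) : 0 <= D -> clamp D u - clamp D v <= `|u - v|.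
  move=> D0; have h := ler_norm (u - v); have h0 := normr_ge0 (u - v).
  have v_le : Num.min v D <= clamp D v by rewrite le_max lexx orbT.
  have u_le : Num.min u D <= Num.min v D + `|u - v|.
    have [uu uD] : Num.min u D <= u /\ Num.min u D <= D by rewrite !ge_min !lexx orbT.
    by case: (ltP v D) => _; lra.
  rewrite lerBlDr {1}/clamp ge_max; apply/andP; split.
    by have := clamp_ge0 D v; lra.
  by lra.
move=> D0; rewrite ler_norml; have := key s t D0; have := key t s D0.
by rewrite (distrC t s); lra.
Qed.

Lemma segment_point_lipschitz x y s t :
  mdist (segment_point x y s) (segment_point x y t) <= `|s - t|.
Proof.
apply: le_trans (clamp_lipschitz s t (vdist_ge0 x y)).
rewrite mdist_tree; apply: pdist_le => b b'.
rewrite /gap/=; set u := clamp _ s; set v := clamp _ t.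
have h1 := ler_norm (u - v).
have := ler_norm (v - u); rewrite distrC => h2; have h0 := normr_ge0 (u - v).
have u0 : 0 <= u := clamp_ge0 _ _; have v0 : 0 <= v := clamp_ge0 _ _.
have uD : 0 <= d x y - u := clamp_le _ (vdist_ge0 x y).
have vD : 0 <= d x y - v := clamp_le _ (vdist_ge0 x y).
by case: b; case: b'; rewrite ?vdistxx ?(vdist_sym y x); lra.
Qed.

Lemma segment_point_continuous x y : continuous (segment_point x y).
Proof.
move=> s; apply/cvgrPdist_lt => e e0; near=> t.
apply: le_lt_trans (segment_point_lipschitz x y s t) _.
by near: t; exact: (nbhsx_ballx s e e0).
Unshelve. all: by end_near. Qed.

Lemma compact_segment x y : compact (segment_point x y @` `[0, d x y]).
Proof.
apply: continuous_compact; last exact: segment_compact.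
exact/continuous_subspaceT/segment_point_continuous.
Qed.

End Segments.
(** * The action of a free group on its Cayley tree *)

Section HullAction.
Context {R : realType} {V : fourpoint_space R} {G : groupType}.
Local Notation d := (@vdist R V).
Variable m : G -> V -> V.
Hypotheses (m1 : forall x, m 1%g x = x)
  (mM : forall g h x, m (g * h)%g x = m g (m h x))
  (m_iso : forall g x y, d (m g x) (m g y) = d x y).
Implicit Types (g h : G) (p q : position V).

Lemma move_depth_sum g p :
  depth p true + depth p false = d (m g (endv p true)) (m g (endv p false)).
Proof. by rewrite m_iso depth_sum. Qed.

Definition move_position g p : position V :=
  @Position R V (fun b => m g (endv p b)) (depth p) (@depth_ge0 R V p)
    (move_depth_sum g p).

Lemma pdist_move g p q : pdist (move_position g p) (move_position g q) = pdist p q.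
Proof. by rewrite /pdist /gap/= !m_iso. Qed.

Definition hull_act_fun g (a : tree_hull V) : tree_hull V :=
  at_position (move_position g (position_of a)).

Lemma hull_actE g p :
  hull_act_fun g (at_position p) = at_position (move_position g p).
Proof.
apply/at_position_eq; rewrite pdist_move; apply/at_position_eq.
by rewrite position_ofK.
Qed.

Lemma hull_act1 a : hull_act_fun 1%g a = a.
Proof.
rewrite -{2}(position_ofK a); apply/at_position_eq.
by rewrite -[RHS](pdistxx (position_of a)) /pdist /gap/= !m1.
Qed.

Lemma hull_actM g h a : hull_act_fun (g * h)%g a = hull_act_fun g (hull_act_fun h a).
Proof.
rewrite [hull_act_fun h a]/hull_act_fun hull_actE; apply/at_position_eq.
by rewrite -[RHS](pdistxx (move_position (g * h)%g (position_of a)))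
  /pdist /gap/= !mM.
Qed.

Lemma hull_act_isometric g a b : mdist (hull_act_fun g a) (hull_act_fun g b) = mdist a b.
Proof. by rewrite mdist_tree pdist_move. Qed.

Definition hull_action : isometric_action G (tree_hull V) :=
  IsometricAction hull_act1 hull_actM hull_act_isometric.

Lemma hull_action_vertex g x : hull_action g (at_vertex x) = at_vertex (m g x).
Proof.
rewrite /= {1}/at_vertex hull_actE; apply/at_position_eq.
by rewrite -[RHS](pdistxx (on_segment (lexx 0) (lexx 0) (vdist0E (m g x)))).
Qed.

End HullAction.

Section FreeTreeAction.
Context {R : realType} {n : nat} {F : groupType} {x : 'I_n -> F}.
Local Notation letter := ('I_n * bool)%type.
Implicit Types (a b : letter) (w u v : seq letter) (g h : F).

Context {nf : F -> seq letter} (nf_reduced : forall g, reduced (nf g))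
  (nfK : forall g, word_val x (nf g) = g)
  (nf_val : forall w, reduced w -> nf (word_val x w) = w).
Context {ell : 'I_n -> R} (ell_ge1 : forall i, 1 <= ell i).

Definition cayley_space : fourpoint_space R :=
  word_space nf_reduced nfK nf_val ell_ge1.

Definition cayley_tree : metricType R := tree_hull cayley_space.

Definition cayley_action : isometric_action F cayley_tree :=
  @hull_action R cayley_space F (fun g h => (g * h)%g)
    (@mul1g F) (fun g h k => esym (mulgA g h k)) (@word_dist_trans R n F nf ell).

Definition cayley_vertex g : cayley_tree := @at_vertex R cayley_space g.

Lemma cayley_action_vertex g h :
  cayley_action g (cayley_vertex h) = cayley_vertex (g * h)%g.
Proof. exact: (@hull_action_vertex R cayley_space F). Qed.

Lemma mdist_cayley_vertex g h :
  mdist (cayley_vertex g) (cayley_vertex h) = weight ell (nf (g^-1 * h)%g).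
Proof. exact: (@mdist_vertex R cayley_space). Qed.

Lemma vdist_word g w : reduced w ->
  @vdist R cayley_space g (g * word_val x w)%g = weight ell w.
Proof. by move=> rw; rewrite /= /word_dist mulKg nf_val. Qed.

Lemma reduced1 a : reduced [:: a].
Proof. by []. Qed.

Lemma vdist_letter g a :
  @vdist R cayley_space g (g * letter_val x a)%g = ell a.1.
Proof.
rewrite -[letter_val x a]mulg1 (vdist_word g (reduced1 a)).
by rewrite weight_cons weight_nil addr0.
Qed.

(** Walking along the reduced word leads to the edge that carries the point. The
    letter [a0] supplies an edge when the word is empty. *)
Lemma on_edge (a0 : letter) g w (s : R) : reduced w -> 0 <= s <= weight ell w ->
  exists h a t, 0 <= t <= ell a.1 /\
    @segment_point R cayley_space g (g * word_val x w)%g s =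
    @segment_point R cayley_space h (h * letter_val x a)%g t.
Proof.
elim: w g s => [|a w IH] g s rw.
  rewrite weight_nil -eq_le => /eqP <-; exists g, a0, 0; split.
    by rewrite lexx ltW//; exact: lt_le_trans (ell_ge1 _).
  rewrite /= mulg1 [RHS](@segment_point_prefix _ _ _ _ (g : cayley_space))//.
    by rewrite vdistxx add0r.
  by rewrite vdistxx lexx.
have [sa|sa] := leP s (ell a.1) => /andP[s0 sw].
  exists g, a, s; split; first by rewrite s0.
  apply: segment_point_prefix; last by rewrite vdist_letter s0.
  rewrite vdist_word// vdist_letter weight_cons /= mulgA.
  by rewrite [X in _ = _ + X]vdist_word//; exact: reduced_cons rw.
have := IH (g * letter_val x a)%g (s - ell a.1) (reduced_cons rw).
rewrite -mulgA => -[|h [b [t [tb E]]]].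
  by move: sw; rewrite weight_cons; lra.
exists h, b, t; split=> //; rewrite -E -(vdist_letter g a).
rewrite /= mulgA.
apply: segment_point_suffix.
  rewrite -mulgA [LHS](@vdist_word g (a :: w))// vdist_letter weight_cons /= mulgA.
  by rewrite [X in _ = _ + X]vdist_word//; exact: reduced_cons rw.
by rewrite -mulgA vdist_letter [X in _ <= _ <= X](@vdist_word g (a :: w))// ltW.
Qed.

Lemma cayley_edge_point (a0 : letter) (p : cayley_tree) : exists h a t,
  0 <= t <= ell a.1 /\
  p = @segment_point R cayley_space h (h * letter_val x a)%g t.
Proof.
have [g [h [s [sgh ->]]]] := segment_pointP p.
have -> : h = (g * word_val x (nf (g^-1 * h)%g))%g by rewrite nfK mulVKg.
exact: on_edge.
Qed.

Lemma size_weight w : (size w)%:R <= weight ell w.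
Proof.
elim: w => [|a w IH]; first by rewrite weight_nil.
by rewrite weight_cons /= -natr1 addrC lerD.
Qed.

Lemma finite_short_words (k : nat) : finite_set [set w : seq letter | (size w <= k)%N].
Proof.
apply: (sub_finite_set _ (finite_image (fun w : k.-bseq letter => val w)
  (finite_finset : finite_set [set: k.-bseq letter]))) => w /= wk.
by exists (Bseq wk).
Qed.

Lemma finite_weight_ball (r : R) : finite_set [set g | weight ell (nf g) <= r].
Proof.
apply: sub_finite_set (finite_image (word_val x) (finite_short_words (Num.truncn r))).
move=> g /= gr; exists (nf g) => //=.
rewrite -ltnS -(ltr_nat R); apply: le_lt_trans (truncnS_gt _).
exact: le_trans (size_weight _) gr.
Qed.

Context {L : R} (ell_le : forall i, ell i <= L) (a0 : letter).

Lemma near_vertex (p : cayley_tree) : exists g, mdist (cayley_vertex g) p <= L.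
Proof.
have [h [a [t [ta ->]]]] := cayley_edge_point a0 p; exists h.
apply: le_trans (@mdist_vertex_segment R cayley_space _ _ _ _) _.
  by rewrite vdist_letter.
by case/andP: ta => _ ta; apply: le_trans ta _.
Qed.

(** A ball meets only finitely many edges, and edges are compact. *)
Lemma proper_cayley_tree : proper_space cayley_tree.
Proof.
move=> p r.
pose D : set (F * letter)%type :=
  [set g | weight ell (nf g) <= mdist (cayley_vertex 1%g) p + r + L] `*` setT.
have fD : finite_set D.
  by apply: finite_setX; [exact: finite_weight_ball|exact: finite_finset].
pose E (ga : F * letter) : set cayley_tree :=
  @segment_point R cayley_space ga.1 (ga.1 * letter_val x ga.2)%g
    @` `[0, @vdist R cayley_space ga.1 (ga.1 * letter_val x ga.2)%g].
have cE : compact (\bigcup_(ga in D) E ga).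
  rewrite -bigsetU_fset_set//; apply: bigsetU_compact => ga _.
  exact: compact_segment.
apply: subclosed_compact cE _.
  rewrite closure_id; apply/seteqP; split; first exact: subset_closure.
  move=> y cy /=; apply/ler_addgt0Pl => e e0.
  have [|z /= [pz yz]] := cy [set z | mdist y z < e].
    by apply: (cvgr_dist_lt (f := id) (F := nbhs y)) => //; exact: cvg_id.
  by have := metric_triangle p z y; rewrite (metric_sym z); lra.
move=> y /= py; have [h [a [t [ta yE]]]] := cayley_edge_point a0 y.
have hy : mdist (cayley_vertex h) y <= L.
  rewrite yE; apply: le_trans (@mdist_vertex_segment R cayley_space _ _ _ _) _.
    by rewrite vdist_letter.
  by case/andP: ta => _ ta; apply: le_trans ta _.
exists (h, a).
  split=> //=; have := metric_triangle (cayley_vertex 1%g) p (cayley_vertex h).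
  have := metric_triangle p y (cayley_vertex h).
  by rewrite (metric_sym y) mdist_cayley_vertex invg1 mul1g; lra.
have tE : t \in `[0, @vdist R cayley_space h (h * letter_val x a)%g].
  by rewrite vdist_letter in_itv.
by exists t.
Qed.

Lemma cayley_tree_CAT0 : CAT0_space cayley_tree.
Proof.
have cn : CN_inequality cayley_tree := CN_tree_hull.
split; first by exists (cayley_vertex 1%g).
- exact: proper_cayley_tree.
- exact: CN_geodesic_space.
- exact: CN_CAT0_inequality.
Qed.

Lemma cayley_action_geometric : geometric_action cayley_action.
Proof.
split.
  apply: (@orbit_proper _ _ _ _ (cayley_vertex 1%g)) => r.
  apply: sub_finite_set (finite_weight_ball r) => g.
  by rewrite /mkset cayley_action_vertex mdist_cayley_vertex invg1 mul1g mulg1.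
apply: (@orbit_cocompact _ _ _ _ proper_cayley_tree (cayley_vertex 1%g) L) => p.
by have [g gp] := near_vertex p; exists g; rewrite cayley_action_vertex mulg1.
Qed.

End FreeTreeAction.
(** * Two sequences with and without a common limit *)

Section Halfway.
Context {R : realType} {X : metricType R} (cn : CN_inequality X).
Implicit Types (p q m w : X) (t : R).

(** Segments from [p] with the same midpoint [w] agree up to [w]. *)
Lemma fraction_point_shared_half t p q q' w m : 0 <= t <= 2^-1 ->
  mdist p q = mdist p q' -> mdist p w <= 2^-1 * mdist p q ->
  mdist w q <= 2^-1 * mdist p q -> mdist w q' <= 2^-1 * mdist p q ->
  fraction_point t p q m -> fraction_point t p q' m.
Proof.
move=> t12 pqq' pw wq wq' hm.
have t01 : 0 <= t <= 1 by lra.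
have t201 : 0 <= 2 * t <= 1 by lra.
have [m' hm'] := cn p w t201; have [pm' m'w] := fraction_point_dist t201 hm'.
have pm'_le : mdist p m' <= t * mdist p q.
  by rewrite pm'; have := ler_wpM2l (proj1 (andP t201)) pw; lra.
have t2_ge0 : 0 <= 1 - 2 * t by lra.
have m'w_le := ler_wpM2l t2_ge0 pw.
have m'q : mdist m' q <= (1 - t) * mdist p q.
  by have := metric_triangle m' w q; lra.
have m'q' : mdist m' q' <= (1 - t) * mdist p q.
  by have := metric_triangle m' w q'; lra.
have <- : m' = m by exact: (fraction_point_unique t01 hm).
by apply: fraction_pointI => //; rewrite -pqq'.
Qed.

End Halfway.

Section JoinDirections.
Context {R : realType} {T Y : metricType R}.
Hypotheses (cnT : CN_inequality T) (cnY : CN_inequality Y).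
Implicit Types (u w : nat -> T) (q : nat -> Y).

Lemma segments_converge_shared_half v0 y0 u u' w q (c : ray (l2prod T Y)) :
  (forall i, mdist v0 (u i) = mdist v0 (u' i)) ->
  (forall i, mdist v0 (w i) <= 2^-1 * mdist v0 (u i)) ->
  (forall i, mdist (w i) (u i) <= 2^-1 * mdist v0 (u i)) ->
  (forall i, mdist (w i) (u' i) <= 2^-1 * mdist v0 (u i)) ->
  c 0 = (v0, y0) ->
  segments_converge (fun i => (u i, q i) : l2prod T Y) c ->
  segments_converge (fun i => (u' i, q i) : l2prod T Y) c.
Proof.
move=> uu' vw wu wu' c0 cvg r e r0 e0.
have r20 : 0 < 2 * r by rewrite mulr_gt0.
apply: filterS2 (cvg _ _ r0 e0) (cvg _ _ r20 ltr01) => i.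
have -> : mdist (c 0) ((u' i, q i) : l2prod T Y) = mdist (c 0) (u i, q i).
  by rewrite c0 -[LHS]/(l2dist _ _) -[RHS]/(l2dist _ _) /l2dist/= uu'.
set D := mdist _ _ => -[rD [m hm mc]] [r2D _]; split=> //; exists m => //.
have D0 : 0 < D by lra.
have rD01 : 0 <= r / D <= 1 by apply: div_itv01; rewrite // ltW// ltW.
have [h1 h2] := fraction_point_components cnT cnY rD01 hm.
apply: fraction_point_prod => //; rewrite c0 /= in h1 *.
apply: fraction_point_shared_half (vw i) (wu i) (wu' i) h1 => //.
apply/andP; split; first by rewrite divr_ge0 ?ltW.
by rewrite ler_pdivrMr//; lra.
Qed.

(** The second component of a geodesic in a product moves at a constant speed, the
    ratio of the distance of its ends to the length of the geodesic. *)
Lemma speed_snd (z p m : l2prod T Y) (r : R) : 0 < r -> r < mdist z p ->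
  fraction_point (r / mdist z p) z p m ->
  mdist z.2 m.2 = r * mdist z.2 p.2 / mdist z p.
Proof.
move=> r0 rD hm; have D0 := lt_trans r0 rD.
have rD01 : 0 <= r / mdist z p <= 1 by apply: div_itv01; rewrite // !ltW.
have [_ h2] := fraction_point_components cnT cnY rD01 hm.
by have [-> _] := fraction_point_dist rD01 h2; rewrite mulrAC.
Qed.

(** Write [E] and [D] for the distances of [z] to the [i]-th point of the first
    sequence, measured in [Y] and in the product, and [D'] for the analogue of [D] for
    the second sequence. At time 1, the [Y]-components of the segments from [z] are
    at the distances [E / D] and [E / D'] from their origin. These ratios tend to
    [1 / sqrt 5 > 2 / 5] and [1 / sqrt 10 < 7 / 20], so the segments cannot both
    be close to the same ray at time 1. *)
Lemma slopes_differ v0 y0 u u' q (k : nat -> nat) (xi : boundary (l2prod T Y)) :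
  (forall N, \forall i \near \oo, (N <= k i)%N) ->
  (forall i, (k i)%:R <= mdist y0 (q i) < (k i).+1%:R) ->
  (forall i, mdist v0 (u i) = 2 * (k i)%:R) ->
  (forall i, mdist v0 (u' i) = 3 * (k i)%:R) ->
  interior_point ((u i, q i) : l2prod T Y) @[i --> \oo] --> ideal_point xi ->
  interior_point ((u' i, q i) : l2prod T Y) @[i --> \oo] --> ideal_point xi ->
  False.
Proof.
move=> k_oo kq vu vu'; have -> : xi = endpoint (repr xi) by rewrite /endpoint reprK.
move: (repr xi) => {xi} c cu cu'.
have e0 : 0 < 80^-1 :> R by rewrite invr_gt0.
set z := c 0; pose A0 := mdist z.1 v0; pose B0 := mdist z.2 y0.
have A0_ge0 : 0 <= A0 by exact: mdist_ge0.
have B0_ge0 : 0 <= B0 by exact: mdist_ge0.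
have h1 := cvg_ideal_point_near ltr01 e0 cu.
have h2 := cvg_ideal_point_near ltr01 e0 cu'.
(* this lower bound on [k i] absorbs the change of base point from [(v0, y0)] to
   [z] in all estimates below *)
have h3 := k_oo (Num.truncn (10 * A0 + 30 * B0 + 30)).+1.
have [i [[[zu [s gs sc]] [zu' [s' gs' sc']]] ki]] :=
  filter_ex (filterI (filterI h1 h2) h3).
move: zu gs sc zu' gs' sc'; rewrite -/z.
set p := (u i, q i) : l2prod T Y; set p' := (u' i, q i) : l2prod T Y.
move=> zp gs sc zp' gs' sc'.
have cn := CN_prod cnT cnY.
have D0 := lt_trans ltr01 zp; have D0' := lt_trans ltr01 zp'.
have hm : fraction_point (1 / mdist z p) z p (s 1).
  by apply: geodesic_fraction_point_div; rewrite // ler01 ltW.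
have hm' : fraction_point (1 / mdist z p') z p' (s' 1).
  by apply: geodesic_fraction_point_div; rewrite // ler01 ltW.
have E1 := speed_snd ltr01 zp hm; have E2 := speed_snd ltr01 zp' hm'.
rewrite !mul1r in E1 E2.
have close : mdist z.2 (s 1).2 - mdist z.2 (s' 1).2 < 40^-1.
  have := metric_triangle z.2 (s' 1).2 (s 1).2.
  have : mdist (s' 1).2 (s 1).2 <= mdist (s' 1) (s 1) := l2dist_snd _ _.
  have := metric_triangle (s' 1) (c 1) (s 1).
  by rewrite (metric_sym (c 1) (s 1)) in sc *; lra.
have kK : 10 * A0 + 30 * B0 + 30 <= (k i)%:R.
  by apply: le_trans (ltW (truncnS_gt _)) _; rewrite ler_nat.
have [kq1 kq2] := andP (kq i).
rewrite -natr1 in kq2.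
set E := mdist z.2 (q i); set A := mdist z.1 (u i); set A' := mdist z.1 (u' i).
have Eq : (k i)%:R - B0 <= E.
  by have := metric_triangle y0 z.2 (q i); rewrite (metric_sym y0 z.2) -/E -/B0; lra.
have Eq' : E <= (k i)%:R + 1 + B0.
  by have := metric_triangle z.2 y0 (q i); rewrite -/E -/B0; lra.
have Au : A <= 2 * (k i)%:R + A0.
  by have := metric_triangle z.1 v0 (u i); rewrite -/A -/A0 vu; lra.
have Au' : 3 * (k i)%:R - A0 <= A'.
  by have := metric_triangle v0 z.1 (u' i); rewrite (metric_sym v0 z.1) -/A' -/A0 vu'; lra.
have DE : mdist z p ^+ 2 = A ^+ 2 + E ^+ 2 by exact: l2dist_sqr.
have DE' : mdist z p' ^+ 2 = A' ^+ 2 + E ^+ 2 by exact: l2dist_sqr.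
have A_ge0 : 0 <= A by exact: mdist_ge0.
have E_ge0 : 0 <= E by exact: mdist_ge0.
have A'_ge0 : 0 <= A' by exact: mdist_ge0.
have fast : 2 / 5 <= E / mdist z p.
  rewrite ler_pdivlMr//; apply: le_of_sqr => //; rewrite exprMn DE.
  have AE : A <= 11 / 5 * E by lra.
  have : A ^+ 2 <= (11 / 5 * E) ^+ 2 by rewrite lerXn2r ?nnegrE ?mulr_ge0.
  by rewrite !exprMn; have := sqr_ge0 E; lra.
have slow : E / mdist z p' <= 7 / 20.
  rewrite ler_pdivrMr//; apply: le_of_sqr; first by rewrite mulr_ge0 ?ltW.
  rewrite exprMn DE'; have AE : 27 / 10 * E <= A' by lra.
  have : (27 / 10 * E) ^+ 2 <= A' ^+ 2 by rewrite lerXn2r ?nnegrE ?mulr_ge0.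
  by rewrite !exprMn; have := sqr_ge0 E; lra.
rewrite /= -/E in E1 E2; rewrite E1 E2 in close; lra.
Qed.

End JoinDirections.
Section PositiveWords.
Variable n : nat.
Local Notation letter := ('I_n * bool)%type.

Lemma positive_reduced (w : seq letter) : all snd w -> reduced w.
Proof.
case: w => //= a w /andP[a2 w2].
elim: w a a2 w2 => //= b w IH a a2 /andP[b2 w2]; rewrite IH// andbT.
by apply: contraL b2 => /eqP ->; rewrite /= a2.
Qed.

Lemma weight_nseq (R : realType) (ell : 'I_n -> R) (a : letter) k :
  weight ell (nseq k a) = k%:R * ell a.1.
Proof.
elim: k => [|k IH]; first by rewrite weight_nil mul0r.
by rewrite weight_cons IH -natr1; lra.
Qed.

End PositiveWords.

Theorem mainTheorem5 (R : realType) (n : nat) (F H : groupType) :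
  (2 <= n)%N -> free_group_of_rank n F ->
  infinite_set [set: H]%classic -> CAT0_group R H ->
  CAT0_group R (F * H)%type ->
  ~ equivariant_rigid R (F * H)%type.
Proof.
move=> n2 [x free] infH [Y [catY [b geoY]]] _ rigid.
have [nf [nf_reduced nfK nf_val]] := normal_form_exists free.
pose i0 : 'I_n := Ordinal (ltnW n2); pose i1 : 'I_n := Ordinal n2.
pose ell1 (i : 'I_n) : R := 1; pose ell2 (i : 'I_n) : R := if i == i1 then 2 else 1.
have ell1_ge1 i : 1 <= ell1 i by [].
have ell2_ge1 i : 1 <= ell2 i by rewrite /ell2; case: eqP => _; lra.
have ell1_le i : ell1 i <= 2 by rewrite /ell1; lra.
have ell2_le i : ell2 i <= 2 by rewrite /ell2; case: eqP => _; lra.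
pose a0 : 'I_n * bool := (i0, true); pose a1 : 'I_n * bool := (i1, true).
pose T1 := cayley_tree nf_reduced nfK nf_val ell1_ge1.
pose T2 := cayley_tree nf_reduced nfK nf_val ell2_ge1.
pose act1 := cayley_action nf_reduced nfK nf_val ell1_ge1.
pose act2 := cayley_action nf_reduced nfK nf_val ell2_ge1.
have catT1 : CAT0_space T1 := cayley_tree_CAT0 nf_reduced nfK nf_val ell1_ge1 ell1_le a0.
have catT2 : CAT0_space T2 := cayley_tree_CAT0 nf_reduced nfK nf_val ell2_ge1 ell2_le a0.
have geoT1 : geometric_action act1 :=
  cayley_action_geometric nf_reduced nfK nf_val ell1_ge1 ell1_le a0.
have geoT2 : geometric_action act2 :=
  cayley_action_geometric nf_reduced nfK nf_val ell2_ge1 ell2_le a0.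
have [T1_ne T1_proper T1_geo T1_cat] := catT1.
have [T2_ne T2_proper T2_geo T2_cat] := catT2.
have [Y_ne Y_proper Y_geo Y_cat] := catY.
have cnT1 := CAT0_CN T1_geo T1_cat; have cnT2 := CAT0_CN T2_geo T2_cat.
have cnY := CAT0_CN Y_geo Y_cat; have [y0 _] := Y_ne.
pose v1 : T1 := cayley_vertex nf_reduced nfK nf_val ell1_ge1 1%g.
pose v2 : T2 := cayley_vertex nf_reduced nfK nf_val ell2_ge1 1%g.
pose half k := word_val x (nseq k a0).
pose alpha k := word_val x (nseq (k + k) a0).
pose beta k := word_val x (nseq k a0 ++ nseq k a1).
(* [H] is infinite and only finitely many orbit points lie in a given ball *)
have /choice[h hh] : forall i : nat, exists h, i%:R < mdist y0 (b h y0).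
  move=> i; apply: contrapT => /forallNP near_y0; apply: infH.
  apply: sub_finite_set (proper_orbit Y_proper y0 i%:R geoY.1) => h _ /=.
  by rewrite leNgt; apply/negP.
pose rho i := mdist y0 (b (h i) y0); pose k i := Num.truncn (rho i).
have k_le i : (k i)%:R <= rho i < (k i).+1%:R.
  by apply: truncn_itv; exact: mdist_ge0.
have k_ge i : (i <= k i)%N.
  have := lt_trans (hh i) (proj2 (andP (k_le i))).
  by rewrite ltr_nat ltnS.
pose V1 g : T1 := cayley_vertex nf_reduced nfK nf_val ell1_ge1 g.
pose V2 g : T2 := cayley_vertex nf_reduced nfK nf_val ell2_ge1 g.
have pos_alpha j : all snd (nseq j a0) by elim: j.
have pos_beta j : all snd (nseq j a1) by elim: j.
have halfE j w : all snd w ->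
    mdist (V1 (half j)) (V1 (half j * word_val x w)%g) = weight ell1 w.
  by move=> pw; rewrite mdist_cayley_vertex mulKg nf_val// positive_reduced.
have distE1 w : all snd w -> mdist v1 (V1 (word_val x w)) = weight ell1 w.
  by move=> pw; rewrite mdist_cayley_vertex invg1 mul1g nf_val// positive_reduced.
have distE2 w : all snd w -> mdist v2 (V2 (word_val x w)) = weight ell2 w.
  by move=> pw; rewrite mdist_cayley_vertex invg1 mul1g nf_val// positive_reduced.
have pos_ab j : all snd (nseq j a0 ++ nseq j a1).
  by rewrite all_cat pos_alpha pos_beta.
have alphaE j : alpha j = (half j * half j)%g.
  by rewrite /alpha nseqD word_val_cat.
have betaE j : beta j = (half j * word_val x (nseq j a1))%g.
  by rewrite /beta word_val_cat.
have orbit1 g j : prod_action act1 b (g, h j) (v1, y0) = (V1 g, b (h j) y0).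
  by rewrite -[LHS]/(act1 g (V1 1%g), b (h j) y0) cayley_action_vertex mulg1.
have orbit2 g j : prod_action act2 b (g, h j) (v2, y0) = (V2 g, b (h j) y0).
  by rewrite -[LHS]/(act2 g (V2 1%g), b (h j) y0) cayley_action_vertex mulg1.
have cn1 := CN_prod cnT1 cnY.
have escape r : \forall i \near \oo,
    r < mdist ((v1, y0) : l2prod T1 Y) (V1 (alpha (k i)), b (h i) y0).
  near=> i; apply: lt_le_trans (@l2dist_snd _ _ _ (_, _) (_, _)).
  by apply: le_lt_trans (hh i); near: i; exact: nbhs_infty_ger.
have [phi [c [phi_ge c0 cvg_alpha]]] :=
  segments_subconverge cn1 (proper_prod T1_proper Y_proper) escape.
have cvg_beta : segments_converge
    ((fun i => (V1 (beta (k i)), b (h i) y0) : l2prod T1 Y) \o phi) c.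
  apply: (segments_converge_shared_half cnT1 cnY
    (w := fun i => V1 (half (k (phi i)))) _ _ _ _ c0 cvg_alpha) => i.
  - by rewrite !distE1// weight_cat nseqD weight_cat !weight_nseq.
  - by rewrite !distE1// nseqD weight_cat !weight_nseq /=; lra.
  - by rewrite distE1// nseqD alphaE halfE// weight_cat weight_nseq /=; lra.
  - by rewrite distE1// nseqD betaE halfE// weight_cat !weight_nseq /=; lra.
have [f [_ _ [_ ext]]] := rigid _ _ (prod_action act1 b) (prod_action act2 b)
  (CAT0_prod catT1 catY) (CAT0_prod catT2 catY)
  (prod_geometric T1_proper Y_proper T1_ne Y_ne geoT1 geoY)
  (prod_geometric T2_proper Y_proper T2_ne Y_ne geoT2 geoY) (v1, y0) (v2, y0).
(* the limit of an orbit sequence in the second product is the image under [f] of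
   its limit in the first one *)
have lim g : segments_converge
      ((fun i => (V1 (g (k i)), b (h i) y0) : l2prod T1 Y) \o phi) c ->
    interior_point ((V2 (g (k (phi i))), b (h (phi i)) y0) : l2prod T2 Y)
      @[i --> \oo] --> ideal_point (f (endpoint c)).
  move=> cvg_g.
  under eq_fun do rewrite -orbit2.
  apply: (ext (fun i => (g (k (phi i)), h (phi i)))).
  under eq_fun do rewrite orbit1.
  exact: segments_converge_cvg.
apply: (slopes_differ cnT2 cnY (v0 := v2) (y0 := y0) (k := k \o phi) _ _ _ _ (lim _ cvg_alpha) (lim _ cvg_beta)).
- move=> N; near=> i; apply: leq_trans (k_ge _); apply: leq_trans (phi_ge i).
  by near: i; exact: nbhs_infty_ge.
- by move=> i; exact: k_le.
- by move=> i; rewrite distE2// nseqD weight_cat !weight_nseq /ell2/=; lra.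
- by move=> i; rewrite distE2// weight_cat !weight_nseq /ell2/=; lra.
Unshelve. all: by end_near. Qed.
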